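(* Assume all of the following. (1) For all $i=1,\dots,N$, the function $f_i:\mathbb{R}^{n_i}\to\mathbb{R}$ is convex and the set $X_i\subset\mathbb{R}^{n_i}$ is convex and compact. (2) The primal problem $(\mathcal{P})$ admits an optimal solution and the dual problem $(\mathcal{D})$ admits an optimal solution. (3) The graph $\mathcal{G}$ is undirected and connected, i.e., $(i,j)\in\mathcal{E}$ if and only if $(j,i)\in\mathcal{E}$, and every pair of vertices is joined by a path of edges in $\mathcal{E}$. (4) For all $i,j$: $w_{ij}\in[0,1)$ and $w_{ij}=w_{ji}$; $\sum_{i=1}^N w_{ij}=1$ for all $j$; $\sum_{j=1}^N w_{ij}=1$ for all $i$; and $w_{ij}>0$ if and only if $(i,j)\in\mathcal{E}$. (5) The matrix $\mathcal{W}=[w_{ij}]\in\mathbb{R}^{N\times N}$ is positive semidefinite. Then any sequences generated by the Tracking-ADMM algorithm satisfy: (i) $\lim_{k\to\infty}\|\boldsymbol{e}^{\boldsymbol{d}}_k\|=0$; (ii) $\lim_{k\to\infty}\|\boldsymbol{e}^{\boldsymbol{\lambda}}_k\|=0$; (iii) $\lim_{k\to\infty}\|\bar d_k\|=0$; (iv) for any optimal solution $\boldsymbol{x}^\star$ of $(\mathcal{P})$ and any optimal solution $\lambda^\star$ of $(\mathcal{D})$, setting $\boldsymbol{\lambda}^\star=\mathbb{1}_N\otimes\lambda^\star$, the real sequence $\{\|\bar{\boldsymbol{\lambda}}_k-\boldsymbol{\lambda}^\star\|^2+c^2\|\boldsymbol{z}_k-A_d\boldsymbol{x}^\star\|^2\}_{k\ge0}$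 is convergent.
   Context: Problem. Given $N$ agents, functions $f_i:\mathbb{R}^{n_i}\to\mathbb{R}$, sets $X_i\subset\mathbb{R}^{n_i}$, matrices $A_i\in\mathbb{R}^{p\times n_i}$ ($i=1,\dots,N$) and $b\in\mathbb{R}^p$, the primal problem is $$(\mathcal{P})\qquad \min_{x_1,\dots,x_N}\ \sum_{i=1}^N f_i(x_i)\quad\text{subject to}\quad \sum_{i=1}^N A_ix_i=b,\quad x_i\in X_i,\ i=1,\dots,N.$$ Let $b_1,\dots,b_N\in\mathbb{R}^p$ be any vectors with $\sum_{i=1}^N b_i=b$. The dual problem is $$(\mathcal{D})\qquad \max_{\lambda\in\mathbb{R}^p}\ \sum_{i=1}^N\varphi_i(\lambda),\qquad \varphi_i(\lambda)=\min_{x_i\in X_i} f_i(x_i)+\lambda^\top(A_ix_i-b_i).$$ Network. $\mathcal{G}=(\mathcal{V},\mathcal{E})$ is a graph with $\mathcal{V}=\{1,\dots,N\}$, $\mathcal{E}\subseteq\mathcal{V}\times\mathcal{V}$, $(i,i)\in\mathcal{E}$ for all $i$; $\mathcal{N}_i=\{j\in\mathcal{V}:(i,j)\in\mathcal{E}\}$. Each pair $(i,j)$ carries a weight $w_{ij}$, with $w_{ij}=0$ if $(i,j)\notin\mathcal{E}$. Tracking-ADMM algorithm, with constant penalty parameter $c>0$ (arbitrary). Initialization, for each $i$: $x_{i,0}\in X_i$ arbitrary, $d_{i,0}=A_ix_{i,0}-b_i$, $\lambda_{i,0}\in\mathbb{R}^p$ arbitrary. For $k=0,1,2,\dots$, each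 agent $i$ computes $$\delta_{i,k}=\sum_{j\in\mathcal{N}_i}w_{ij}d_{j,k},\qquad \ell_{i,k}=\sum_{j\in\mathcal{N}_i}w_{ij}\lambda_{j,k},$$ $$x_{i,k+1}\in\arg\min_{x_i\in X_i}\Big\{f_i(x_i)+\ell_{i,k}^\top A_ix_i+\frac c2\|A_ix_i-A_ix_{i,k}+\delta_{i,k}\|^2\Big\}\quad\text{(any minimizer)},$$ $$d_{i,k+1}=\delta_{i,k}+A_ix_{i,k+1}-A_ix_{i,k},\qquad \lambda_{i,k+1}=\ell_{i,k}+c\,d_{i,k+1}.$$ Notation. $\|\cdot\|$ is the Euclidean norm, $\mathbb{1}_N$ the all-ones vector in $\mathbb{R}^N$, $\otimes$ the Kronecker product. $\boldsymbol{x}_k=[x_{1,k}^\top\cdots x_{N,k}^\top]^\top$, and similarly $\boldsymbol{d}_k$, $\boldsymbol{\lambda}_k$ stack $d_{i,k}$, $\lambda_{i,k}$. $A_d=\mathrm{blkdiag}(A_1,\dots,A_N)$. Averages: $\bar d_k=\frac1N\sum_{i=1}^N d_{i,k}$, $\bar\lambda_k=\frac1N\sum_{i=1}^N\lambda_{i,k}$, $\bar{\boldsymbol{d}}_k=\mathbb{1}_N\otimes\bar d_k$, $\bar{\boldsymbol{\lambda}}_k=\mathbb{1}_N\otimes\bar\lambda_k$. Consensus errors: $\boldsymbol{e}^{\boldsymbol{d}}_k=\boldsymbol{d}_k-\bar{\boldsymbol{d}}_k$, $\boldsymbol{e}^{\boldsymbol{\lambda}}_k=\boldsymbol{\lambda}_k-\bar{\boldsymbol{\lambda}}_k$.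 Auxiliary sequence: $\boldsymbol{z}_k=A_d\boldsymbol{x}_k-\bar{\boldsymbol{d}}_k$. *)

(* Defs.v *)
From HB Require Import structures.
From mathcomp Require Export all_boot all_order all_algebra.
From mathcomp Require Export all_classical all_reals all_analysis.

Set Implicit Arguments.
Unset Strict Implicit.
Unset Printing Implicit Defensive.

Import Order.TTheory GRing.Theory Num.Theory.

Local Open Scope classical_set_scope.
Local Open Scope ring_scope.

Section Basics.
Context {R : realType}.

(* The library's norm on matrices is the sup norm. *)
Definition enorm m (v : 'cV[R]_m) : R := Num.sqrt (\sum_i v i 0 ^+ 2).

Definition dotv m (u v : 'cV[R]_m) : R := (u^T *m v) 0 0.

Definition psdmx m (M : 'M[R]_m) : Prop :=
  M^T = M /\ forall v : 'cV[R]_m, 0 <= (v^T *m M *m v) 0 0.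

Definition argmin T (X : set T) (g : T -> R) : set T :=
  [set x | X x /\ forall y, X y -> g x <= g y].

Definition argmax T (X : set T) (g : T -> R) : set T :=
  [set x | X x /\ forall y, X y -> g y <= g x].

(* The attained minimum of g over X; the value is 0 when there is none. *)
Definition min_value T (X : set T) (g : T -> R) : R :=
  xget 0 (g @` argmin X g).

End Basics.

Section Stacking.
Context {R : realType} {N p : nat}.

Definition stack (n : 'I_N -> nat) (x : forall i, 'cV[R]_(n i)) :
    'cV[R]_(\sum_i n i) :=
  \mxcol_i x i.

Definition stackp (v : 'I_N -> 'cV[R]_p) : 'cV[R]_(\sum_(i < N) p) :=
  @stack (fun=> p) v.

(* The Kronecker product of the all-ones vector of R^N with u. *)
Definition ones_kron (u : 'cV[R]_p) : 'cV[R]_(\sum_(i < N) p) :=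
  stackp (fun=> u).

Definition blkdiag (n : 'I_N -> nat) (A : forall i, 'M[R]_(p, n i)) :
    'M[R]_(\sum_(i < N) p, \sum_i n i) :=
  \mxblock_(i, j) (if i == j then A j else 0).

Definition average (v : 'I_N -> 'cV[R]_p) : 'cV[R]_p :=
  N%:R^-1 *: \sum_i v i.

Definition consensus_error (v : 'I_N -> 'cV[R]_p) : 'cV[R]_(\sum_(i < N) p) :=
  stackp v - ones_kron (average v).

End Stacking.

Section Problem.
Context {R : realType} {N p : nat} {n : 'I_N -> nat}.
Variables (f : forall i, 'cV[R]_(n i) -> R) (X : forall i, set 'cV[R]_(n i)).
Variable A : forall i, 'M[R]_(p, n i).

Definition primal_feasible (b : 'cV[R]_p) : set (forall i, 'cV[R]_(n i)) :=
  [set x | \sum_i A i *m x i = b /\ forall i, X (x i)].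

Definition primal_optimal (b : 'cV[R]_p) : set (forall i, 'cV[R]_(n i)) :=
  argmin (primal_feasible b) (fun x => \sum_i f (x i)).

Variable bs : 'I_N -> 'cV[R]_p.

Definition dual_fun (i : 'I_N) (lam : 'cV[R]_p) : R :=
  min_value (@X i) (fun y => f y + dotv lam (A i *m y - bs i)).

Definition dual_optimal : set 'cV[R]_p :=
  argmax setT (fun lam => \sum_i dual_fun i lam).

Variables (E : rel 'I_N) (W : 'M[R]_N).

Definition local_mix (v : 'I_N -> 'cV[R]_p) (i : 'I_N) : 'cV[R]_p :=
  \sum_(j | E i j) W i j *: v j.

(* x k i, d k i and lam k i are the k-th iterates of agent i. *)
Record tracking_admm (c : R) (x : nat -> forall i, 'cV[R]_(n i))
    (d lam : nat -> 'I_N -> 'cV[R]_p) : Prop := {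
  admm_x0 : forall i, X (x 0%N i) ;
  admm_d0 : forall i, d 0%N i = A i *m x 0%N i - bs i ;
  admm_x : forall k i,
    argmin (@X i)
      (fun y => f y + dotv (local_mix (lam k) i) (A i *m y)
                + c / 2 * enorm (A i *m y - A i *m x k i
                                 + local_mix (d k) i) ^+ 2)
      (x k.+1 i) ;
  admm_d : forall k i,
    d k.+1 i = local_mix (d k) i + A i *m x k.+1 i - A i *m x k i ;
  admm_lam : forall k i,
    lam k.+1 i = local_mix (lam k) i + c *: d k.+1 i
}.

End Problem.

(* Main.v *)
(** Write the local vectors as the rows of N x p matrices and let J be the
    averaging matrix.  A minimizer of the augmented Lagrangian of agent i also
    minimizes [f_i + <lam_(i,k+1), A_i .>] over [X_i]; comparing with a saddle
    point (x', lam') gives [<lam_(k+1) - lam', A x_(k+1) - A x'> <= 0].  In terms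
    of a = e^lam, e = c e^d, s = c (z - A x') and g = c J d this reads
    [<J lam_(k+1) - lam', g_(k+1)> + <a_(k+1), s_(k+1)> <= 0], where
    [a_(k+1) = W a_k + e_(k+1)] and [s_(k+1) - s_k = e_(k+1) - W e_k].  This
    linear system is passive: with [rho = (1 - W + J)^-1 (W e - s)] and
    [V = |rho|^2 + 2 <rho, W a> + |a|^2 + <a, W a>], which is nonnegative,
    [2 <a_(k+1), s_(k+1)> = V_(k+1) - V_k + <e_(k+1), W e_(k+1)>
       + <b_k, (1 - W) b_k>], where [b = a + W a].
    Hence [|J lam - lam'|^2 + V] is nonincreasing, and its drops dominate
    [|g|^2] and the Dirichlet form of b; connectivity then yields (i)-(iii).

    This Lyapunov function weights z - A x' by the inverse Laplacian, so (iv) is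
    not read off from it directly.  Instead, a limit point of (x_k, J lam_k) is
    again a saddle point, and the Lyapunov function attached to it tends to 0.
    So J lam_k and z_k converge, and (iv) holds for every pair of vectors.

    Saddle points come from strong duality, proved by letting the weight of a
    quadratic penalty on the coupling constraint tend to infinity. *)

Require Import Defs.
From mathcomp Require Import all_boot all_order all_algebra.
From mathcomp Require Import all_classical all_reals all_analysis.
From mathcomp Require Import ring lra.

Set Implicit Arguments.
Unset Strict Implicit.
Unset Printing Implicit Defensive.

Import Order.TTheory GRing.Theory Num.Theory.
Import numFieldNormedType.Exports.

Local Open Scope classical_set_scope.
Local Open Scope ring_scope.

(** * Limits and the Frobenius product *)

Section RealLimits.
Context {R : realType} {T : Type} {F : set_system T} {FF : Filter F}.

Lemma cvg_eq (f g : T -> R) (a b : R) :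
  f @ F --> a -> f =1 g -> a = b -> g @ F --> b.
Proof. by move=> cf /funext <- <-. Qed.

Lemma cvg_sumr (I : Type) (r : seq I) (P : pred I) (f : I -> T -> R)
    (l : I -> R) :
  (forall i, P i -> f i @ F --> l i) ->
  (fun x => \sum_(i <- r | P i) f i x) @ F --> \sum_(i <- r | P i) l i.
Proof.
move=> cf; elim: r => [|i r IH].
  by rewrite big_nil; under eq_fun do rewrite big_nil; exact: cvg_cst.
rewrite big_cons; under eq_fun do rewrite big_cons.
by case: ifPn => // Pi; apply: cvgD => //; exact: cf.
Qed.

Lemma cvg0_sqr_le (t : R) (u v : T -> R) : 0 < t ->
  (forall x, t * u x ^+ 2 <= v x) -> v @ F --> (0 : R) -> u @ F --> (0 : R).
Proof.
move=> t0 uv cv; apply/cvgrPdistC_lt => e e0.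
have te0 : 0 < t * e ^+ 2 by rewrite mulr_gt0 // exprn_gt0.
move/cvgrPdistC_lt : cv => /(_ _ te0); apply: filterS => x.
rewrite !subr0 => vlt.
rewrite -ltr_sqr ?nnegrE ?(ltW e0) // real_normK ?num_real //.
rewrite -(ltr_pM2l t0) (le_lt_trans (uv x)) //.
exact: le_lt_trans (ler_norm _) vlt.
Qed.

End RealLimits.

Section Entries.
Context {R : pzRingType} {m q : nat}.
Implicit Types U V : 'M[R]_(m, q).

Lemma addmx_entry U V i j : (U + V) i j = U i j + V i j.
Proof. by rewrite mxE. Qed.

Lemma oppmx_entry U i j : (- U) i j = - U i j.
Proof. by rewrite mxE. Qed.

Lemma scalemx_entry (t : R) U i j : (t *: U) i j = t * U i j.
Proof. by rewrite mxE. Qed.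

Lemma zeromx_entry i j : (0 : 'M[R]_(m, q)) i j = 0.
Proof. by rewrite mxE. Qed.

(* Unlike [mxE], leaves products of matrices folded. *)
Definition entryE := (addmx_entry, oppmx_entry, scalemx_entry, zeromx_entry).

End Entries.

Ltac mx_ring := apply/matrixP => ? ?; rewrite ?entryE; ring.

Section FrobeniusProduct.
Context {R : realType} {m q : nat}.
Implicit Types U V : 'M[R]_(m, q).

Definition ip U V : R := \tr (U *m V^T).

Lemma ipE U V : ip U V = \sum_i \sum_j U i j * V i j.
Proof.
by rewrite /ip /mxtrace; apply: eq_bigr => i _; rewrite mxE;
  apply: eq_bigr => j _; rewrite mxE.
Qed.

Lemma ipC U V : ip U V = ip V U.
Proof. by rewrite /ip -mxtrace_tr trmx_mul trmxK. Qed.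

Lemma ipDl U U' V : ip (U + U') V = ip U V + ip U' V.
Proof. by rewrite /ip mulmxDl mxtraceD. Qed.

Lemma ipDr U V V' : ip U (V + V') = ip U V + ip U V'.
Proof. by rewrite ipC ipDl !(ipC U). Qed.

Lemma ipZl t U V : ip (t *: U) V = t * ip U V.
Proof. by rewrite /ip -scalemxAl mxtraceZ. Qed.

Lemma ipZr t U V : ip U (t *: V) = t * ip U V.
Proof. by rewrite ipC ipZl ipC. Qed.

Lemma ipNl U V : ip (- U) V = - ip U V.
Proof. by rewrite -scaleN1r ipZl mulN1r. Qed.

Lemma ipNr U V : ip U (- V) = - ip U V.
Proof. by rewrite ipC ipNl ipC. Qed.

Definition ip_linear := (ipDl, ipDr, ipNl, ipNr, ipZl, ipZr).

Lemma ip_mulmxl (W : 'M[R]_m) U V : ip (W *m U) V = ip U (W^T *m V).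
Proof. by rewrite /ip -mulmxA mxtrace_mulC trmx_mul trmxK mulmxA. Qed.

Lemma sqr_le_ip U i j : U i j ^+ 2 <= ip U U.
Proof.
rewrite ipE (bigD1 i) //= (bigD1 j) //= -expr2 -addrA lerDl addr_ge0 //.
  by apply: sumr_ge0 => k _; rewrite -expr2 sqr_ge0.
by apply: sumr_ge0 => k _; apply: sumr_ge0 => l _; rewrite -expr2 sqr_ge0.
Qed.

Lemma ip_ge0 U : 0 <= ip U U.
Proof.
by rewrite ipE; apply: sumr_ge0 => i _; apply: sumr_ge0 => j _;
  rewrite -expr2 sqr_ge0.
Qed.

Context {T : Type} {F : set_system T} {FF : Filter F}.

Lemma cvg_ip (u v : T -> 'M[R]_(m, q)) (u0 v0 : 'M[R]_(m, q)) :
  (forall i j, (fun k => u k i j) @ F --> u0 i j) ->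
  (forall i j, (fun k => v k i j) @ F --> v0 i j) ->
  (fun k => ip (u k) (v k)) @ F --> ip u0 v0.
Proof.
move=> cu cv; rewrite ipE.
under eq_fun do rewrite ipE.
by apply: cvg_sumr => i _; apply: cvg_sumr => j _; apply: cvgM.
Qed.

Lemma cvg_ip0 (u v : T -> 'M[R]_(m, q)) :
  (forall i j, (fun k => u k i j) @ F --> (0 : R)) ->
  (forall i j, (fun k => v k i j) @ F --> (0 : R)) ->
  (fun k => ip (u k) (v k)) @ F --> (0 : R).
Proof.
move=> cu cv; rewrite [0](_ : _ = ip (0 : 'M[R]_(m, q)) 0); last first.
  by rewrite /ip mul0mx mxtrace0.
by apply: cvg_ip => i j; rewrite mxE.
Qed.

(** Entry by entry, the square of a product [u k i j * v k i j] is at most [M] times the square of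
    the vanishing factor. *)
Lemma cvg_ip0_bounded (M : R) (u v : T -> 'M[R]_(m, q)) :
  (forall k, ip (u k) (u k) <= M) ->
  (forall i j, (fun k => v k i j) @ F --> (0 : R)) ->
  (fun k => ip (u k) (v k)) @ F --> (0 : R).
Proof.
move=> uM cv; under eq_fun do rewrite ipE.
suff uv i j : (fun k => u k i j * v k i j) @ F --> (0 : R).
  have cs : (fun k => \sum_i \sum_j u k i j * v k i j) @ F -->
      \sum_(i < m) \sum_(j < q) (0 : R).
    by apply: cvg_sumr => i _; apply: cvg_sumr => j _; exact: uv.
  by apply: (cvg_eq cs) => //; rewrite big1 // => i _; rewrite big1.
have cMv : (fun k => M * (v k i j * v k i j)) @ F --> (0 : R).
  apply: (cvg_eq (cvgMl_tmp (a := M) (cvgM (cv i j) (cv i j)))) => //.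
  by rewrite !mulr0.
apply: (cvg0_sqr_le ltr01 _ cMv) => k.
rewrite mul1r exprMn -expr2 ler_wpM2r ?sqr_ge0 //.
exact: le_trans (sqr_le_ip _ _ _) (uM k).
Qed.

Lemma cvg_entry0 (u : T -> 'M[R]_(m, q)) :
  (fun k => ip (u k) (u k)) @ F --> (0 : R) ->
  forall i j, (fun k => u k i j) @ F --> (0 : R).
Proof.
move=> cu i j; apply: cvg0_sqr_le ltr01 _ cu => k.
by rewrite mul1r sqr_le_ip.
Qed.

End FrobeniusProduct.

Lemma cvg_mulmx_entry (R : realType) (T : Type) (F : set_system T) {FF : Filter F}
    (l m q : nat) (B : 'M[R]_(l, m))
    (u : T -> 'M[R]_(m, q)) (u0 : 'M[R]_(m, q)) :
  (forall i j, (fun k => u k i j) @ F --> u0 i j) ->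
  forall i j, (fun k => (B *m u k) i j) @ F --> (B *m u0) i j.
Proof.
move=> cu i j; rewrite mxE; under eq_fun do rewrite mxE.
by apply: cvg_sumr => h _; apply: cvgMl_tmp.
Qed.

Lemma cvg_mulmx_entry0 (R : realType) (T : Type) (F : set_system T) {FF : Filter F}
    (l m q : nat) (B : 'M[R]_(l, m))
    (u : T -> 'M[R]_(m, q)) :
  (forall i j, (fun k => u k i j) @ F --> (0 : R)) ->
  forall i j, (fun k => (B *m u k) i j) @ F --> (0 : R).
Proof.
move=> cu i j; rewrite [0](_ : _ = (B *m (0 : 'M[R]_(m, q))) i j); last first.
  by rewrite mulmx0 mxE.
by apply: cvg_mulmx_entry => h t; rewrite mxE.
Qed.

(** * Dirichlet form of the weight matrix and consensus *)

Section Mixing.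
Context {R : realType} {N : nat} (W : 'M[R]_N).
Hypothesis W_sym : W^T = W.
Hypothesis W_row : forall i, \sum_j W i j = 1.

(** Expand the square: unit row and column sums turn each of the two pure terms into [ip v v], and
    the cross terms give [ip v (W *m v)]. So [1%:M - W] is a weighted graph Laplacian. *)
Lemma dirichletE q (v : 'M[R]_(N, q)) :
  ip v v - ip v (W *m v) =
  2^-1 * \sum_i \sum_j \sum_h W i j * (v i h - v j h) ^+ 2.
Proof.
have W_col j : \sum_i W i j = 1.
  by rewrite -(W_row j); apply: eq_bigr => i _; rewrite -{1}W_sym mxE.
have E1 : ip v v = \sum_i \sum_j \sum_h W i j * v i h ^+ 2.
  rewrite ipE; apply: eq_bigr => i _.
  rewrite exchange_big /=; apply: eq_bigr => h _.
  by rewrite -mulr_suml W_row mul1r expr2.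
have E2 : ip v v = \sum_i \sum_j \sum_h W i j * v j h ^+ 2.
  rewrite ipE exchange_big [RHS]exchange_big /= exchange_big /=.
  apply: eq_bigr => j _.
  rewrite exchange_big /=; apply: eq_bigr => h _.
  by rewrite -mulr_suml W_col mul1r expr2.
have E3 : ip v (W *m v) = \sum_i \sum_j \sum_h W i j * (v i h * v j h).
  rewrite ipE; apply: eq_bigr => i _.
  rewrite [RHS]exchange_big /=; apply: eq_bigr => h _.
  rewrite mxE mulr_sumr; apply: eq_bigr => j _; ring.
suff -> : \sum_i \sum_j \sum_h W i j * (v i h - v j h) ^+ 2 =
    ip v v + ip v v - 2 * ip v (W *m v) by field.
rewrite {1}E1 E2 E3 mulr_sumr -big_split /= -sumrB; apply: eq_bigr => i _.
rewrite mulr_sumr -big_split /= -sumrB; apply: eq_bigr => j _.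
rewrite mulr_sumr -big_split /= -sumrB; apply: eq_bigr => h _; ring.
Qed.

Hypothesis W_ge0 : forall i j, 0 <= W i j.

Lemma dirichlet_ge0 q (v : 'M[R]_(N, q)) : ip v (W *m v) <= ip v v.
Proof.
rewrite -subr_ge0 dirichletE mulr_ge0 ?invr_ge0 ?ler0n //.
apply: sumr_ge0 => i _; apply: sumr_ge0 => j _; apply: sumr_ge0 => h _.
by rewrite mulr_ge0 // sqr_ge0.
Qed.

Lemma dirichlet_entry q (v : 'M[R]_(N, q)) i j h :
  W i j * (v i h - v j h) ^+ 2 <= 2 * (ip v v - ip v (W *m v)).
Proof.
rewrite dirichletE mulVKf ?pnatr_eq0 //.
rewrite (bigD1 i) //= (bigD1 j) //= (bigD1 h) //= -!addrA lerDl.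
rewrite !addr_ge0 //.
- by apply: sumr_ge0 => ? _; rewrite mulr_ge0 // sqr_ge0.
- by apply: sumr_ge0 => ? _; apply: sumr_ge0 => ? _; rewrite mulr_ge0 // sqr_ge0.
- apply: sumr_ge0 => ? _; apply: sumr_ge0 => ? _; apply: sumr_ge0 => ? _.
  by rewrite mulr_ge0 // sqr_ge0.
Qed.

Variable E : rel 'I_N.
Hypothesis E_conn : forall i j, connect E i j.
Hypothesis W_pos : forall i j, E i j -> 0 < W i j.

Let J : 'M[R]_N := const_mx N%:R^-1.

(** Positive weights force the differences along every edge to vanish, and paths carry this to all
    pairs of vertices. Since the columns have mean zero, each entry is the mean of its differences
    with the other entries of its column. *)
Lemma consensus_of_dirichlet q (v : nat -> 'M[R]_(N, q)) :
  (forall k, J *m v k = 0) ->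
  (fun k => ip (v k) (v k) - ip (v k) (W *m v k)) @ \oo --> (0 : R) ->
  forall i h, (fun k => v k i h) @ \oo --> (0 : R).
Proof.
move=> Jv cv.
have edge i j h : E i j -> (fun k => v k i h - v k j h) @ \oo --> (0 : R).
  move=> /W_pos w0; apply: (cvg0_sqr_le (t := W i j / 2) _ _ cv).
    by rewrite divr_gt0.
  move=> k; have := dirichlet_entry (v k) i j h; lra.
have all2 i j h : (fun k => v k i h - v k j h) @ \oo --> (0 : R).
  have /connectP[s] := E_conn i j.
  elim: s i => [|i' s IH] i /=.
    by move=> _ ->; under eq_fun do rewrite subrr; apply: cvg_cst.
  move=> /andP[Eii' ps] /(IH _ ps) c2.
  apply: (cvg_eq (cvgD (edge _ _ h Eii') c2)); last by rewrite addr0.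
  by move=> k; exact: subrKA.
move=> i h.
have N0 : (N%:R : R) != 0.
  by rewrite pnatr_eq0 -lt0n; apply: leq_ltn_trans (leq0n i) (ltn_ord i).
have vE k : v k i h = N%:R^-1 * \sum_j (v k i h - v k j h).
  rewrite sumrB sumr_const card_ord -(mulr_natl (v k i h)) mulrBr mulKf //.
  have /matrixP/(_ i h) := Jv k; rewrite !mxE => Jih.
  under eq_bigr => j _ do rewrite -[v k j h](mulKf N0).
  rewrite -mulr_sumr; move: Jih; under eq_bigr do rewrite mxE.
  rewrite -!mulr_sumr => J0.
  have -> : \sum_(i0 < N) v k i0 h = 0.
    by apply/eqP; move/eqP: J0; rewrite mulf_eq0 invr_eq0 (negbTE N0).
  by rewrite !mulr0 subr0.
apply: (cvg_eq (cvgMl_tmp (a := N%:R^-1) (cvg_sumr (r := index_enum _)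
  (P := xpredT) (fun j _ => all2 i j h)))); first by move=> k; rewrite [RHS]vE.
by rewrite big1 // mulr0.
Qed.

End Mixing.

(** * Lyapunov function of the tracking recursion *)

Section Lyapunov.
Context {R : realType} {N p : nat} (W : 'M[R]_N).
Hypothesis W_sym : W^T = W.
Hypothesis W_row : forall i, \sum_j W i j = 1.
Hypothesis W_ge0 : forall i j, 0 <= W i j.
Hypothesis W_psd : forall v : 'M[R]_(N, p), 0 <= ip v (W *m v).
Implicit Types a u rho : 'M[R]_(N, p).

(* The terms in [rho] are forced: the left-hand side of [storage_step] has no
   part quadratic in [rho], so its terms linear in [rho] must cancel exactly. *)
Definition storage rho a : R :=
  ip rho rho + 2 * ip rho (W *m a) + ip a a + ip a (W *m a).

(** The passivity identity of the recursion: with [u] the new tracking error, the second factor on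
    the left becomes the new primal deviation [s]. *)
Lemma storage_step rho a u :
  let b := a + W *m a in
  2 * ip (W *m a + u) (u - (rho - W *m rho)) =
  storage (rho - u) (W *m a + u) - storage rho a
  + ip u (W *m u) + (ip b b - ip b (W *m b)).
Proof.
have adj (x y : 'M[R]_(N, p)) : ip (W *m x) y = ip x (W *m y).
  by rewrite ip_mulmxl W_sym.
rewrite /= /storage !(mulmxDr, mulmxN) !ip_linear !adj.
have sw1 (x y : 'M[R]_(N, p)) : ip x (W *m y) = ip y (W *m x).
  by rewrite -adj ipC.
have sw2 (x y : 'M[R]_(N, p)) : ip x (W *m (W *m y)) = ip y (W *m (W *m x)).
  by rewrite ipC !adj.
have sw3 (x y : 'M[R]_(N, p)) : ip x (W *m (W *m (W *m y))) = ip y (W *m (W *m (W *m x))).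
  by rewrite ipC !adj.
(* Each symmetric pairing through a power of [W] gets one fixed orientation, so that what is left is
   a polynomial identity in scalars. *)
rewrite ?(ipC u a) ?(ipC u rho) ?(ipC a rho) ?(sw1 u a) ?(sw1 u rho) ?(sw1 a rho).
rewrite ?(sw2 u a) ?(sw2 u rho) ?(sw2 a rho) ?(sw3 u a) ?(sw3 u rho) ?(sw3 a rho).
ring.
Qed.

(** The difference of the two sides is [ip a a - ip (W *m a) (W *m a) + ip a (W *m a)]. The last
    term is nonnegative by semidefiniteness. For the rest, [W *m W] is again symmetric and
    nonnegative with unit row sums, so its Dirichlet form is nonnegative. *)
Lemma storage_ge rho a :
  ip (rho + W *m a) (rho + W *m a) <= storage rho a.
Proof.
have W2 := @dirichlet_ge0 _ _ (W *m W) _ _ _ _ a.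
have {}W2 : ip a (W *m W *m a) <= ip a a.
  apply: W2.
  - by rewrite trmx_mul W_sym.
  - move=> i; under eq_bigr do rewrite mxE.
    rewrite exchange_big /= -[RHS](W_row i); apply: eq_bigr => j _.
    by rewrite -mulr_sumr W_row mulr1.
  - by move=> i j; rewrite mxE; apply: sumr_ge0 => k _; apply: mulr_ge0.
rewrite /storage !ip_linear (ipC (W *m a) rho).
rewrite ip_mulmxl W_sym mulmxA; have := W_psd a; lra.
Qed.

End Lyapunov.

Section Averaging.
Context {R : realType} {N : nat}.

Definition avgmx : 'M[R]_N := const_mx N%:R^-1.

Lemma tr_avgmx : avgmx^T = avgmx.
Proof. by apply/matrixP => i j; rewrite !mxE. Qed.

Lemma mulmx_avg (W : 'M[R]_N) :
  (forall i, \sum_j W i j = 1) -> W *m avgmx = avgmx.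
Proof.
move=> W_row; apply/matrixP => i j; rewrite !mxE.
by under eq_bigr do rewrite mxE; rewrite -mulr_suml W_row mul1r.
Qed.

Lemma avgmx_idem : avgmx *m avgmx = avgmx.
Proof.
apply: mulmx_avg => i; under eq_bigr do rewrite mxE.
rewrite sumr_const card_ord -(mulr_natr N%:R^-1) mulVf // pnatr_eq0 -lt0n.
exact: leq_ltn_trans (leq0n i) (ltn_ord i).
Qed.

End Averaging.
Arguments avgmx {R N}.

(** * The tracking recursion compared with a saddle point *)

Section Tracking.
Context {R : realType} {N p : nat} (W : 'M[R]_N) (E : rel 'I_N).
Hypothesis W_sym : W^T = W.
Hypothesis W_row : forall i, \sum_j W i j = 1.
Hypothesis W_ge0 : forall i j, 0 <= W i j.
Hypothesis W_psd : forall v : 'M[R]_(N, p), 0 <= ip v (W *m v).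
Hypothesis E_conn : forall i j, connect E i j.
Hypothesis W_pos : forall i j, E i j -> 0 < W i j.

Local Notation J := (@avgmx R N).

Let WJ : W *m J = J. Proof. exact: mulmx_avg. Qed.
Let JW : J *m W = J.
Proof. by rewrite -{1}tr_avgmx -W_sym -trmx_mul WJ tr_avgmx. Qed.

(** Multiplying a kernel vector [u] by [J] gives [J *m u = 0], hence [W *m u = u]. Its Dirichlet
    form is then zero, and consensus applied to the constant sequence [u] gives [u = 0]. *)
Lemma laplacian_unit : 1%:M - W + J \in unitmx.
Proof.
rewrite -row_free_unit; apply: inj_row_free => v vM0.
have MT : (1%:M - W + J)^T = 1%:M - W + J.
  by rewrite linearD linearB /= trmx1 W_sym tr_avgmx.
have {vM0} : (1%:M - W + J) *m v^T = 0 by rewrite -MT -trmx_mul vM0 trmx0.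
move: v^T (trmxK v) => {v} u <- Mu0.
have Ju0 : J *m u = 0.
  have := congr1 (mulmx J) Mu0; rewrite mulmxA mulmxDr mulmxBr mulmx1 JW.
  by rewrite avgmx_idem subrr add0r mulmx0.
have Wu : W *m u = u.
  move: Mu0; rewrite !mulmxDl Ju0 addr0 mul1mx mulNmx => /eqP.
  by rewrite subr_eq0 => /eqP.
suff -> : u = 0 by rewrite trmx0.
apply/matrixP => i h; rewrite [RHS]mxE.
have cst : (fun k : nat => u i h) @ \oo --> (0 : R).
  apply: (consensus_of_dirichlet W_sym W_row W_ge0 E_conn W_pos
    (v := fun _ => u)) => //.
  by rewrite Wu subrr; exact: cvg_cst.
by apply/esym/(cvg_unique _ cst) => //; exact: cvg_cst.
Qed.

(** The Laplacian [1%:M - W] annihilates the constants; adding [J] repairs this without changing its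
    action on columns of mean zero, where this matrix acts as the pseudo-inverse. *)
Definition laplacian_inv : 'M[R]_N := invmx (1%:M - W + J).
Local Notation G := laplacian_inv.

Let JG : J *m G = J.
Proof.
apply: (can_inj (mulmxK laplacian_unit)).
rewrite -mulmxA mulVmx ?laplacian_unit // mulmx1 mulmxDr mulmxBr mulmx1 JW.
by rewrite subrr add0r avgmx_idem.
Qed.

Lemma laplacian_invP (r : 'M[R]_(N, p)) : J *m r = 0 ->
  G *m r - W *m (G *m r) = r.
Proof.
move=> Jr; have := mulKVmx laplacian_unit r; rewrite -/G !mulmxDl mul1mx mulNmx.
by rewrite (mulmxA J) JG Jr addr0.
Qed.

Lemma laplacian_inv_sub (u : 'M[R]_(N, p)) : J *m u = 0 ->
  G *m (u - W *m u) = u.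
Proof.
move=> Ju; rewrite -[RHS](mulKmx laplacian_unit) -/G !mulmxDl mul1mx mulNmx.
by rewrite Ju addr0.
Qed.

Variables (c : R) (B : 'M[R]_(N, p)) (Y D Lam : nat -> 'M[R]_(N, p)).
Hypothesis c_gt0 : 0 < c.
Hypothesis D0E : J *m D 0%N = J *m (Y 0%N - B).
Hypothesis DS : forall k, D k.+1 = W *m D k + Y k.+1 - Y k.
Hypothesis LamS : forall k, Lam k.+1 = W *m Lam k + c *: D k.+1.

(** Dynamic average consensus: [J *m W = J] removes the mixing, so the increments of [Y] telescope
    from the matching initial value. *)
Lemma avg_tracking k : J *m D k = J *m (Y k - B).
Proof.
elim: k => [|k IH]; first exact: D0E.
rewrite DS !mulmxBr !mulmxDr mulmxA JW IH !mulmxBr; mx_ring.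
Qed.

Variables (Ls Ys : 'M[R]_(N, p)).
Hypothesis JLs : J *m Ls = Ls.
Hypothesis JYs : J *m Ys = J *m B.
Hypothesis saddle_mono :
  forall k, ip (Lam k.+1 - Ls) (Y k.+1 - Ys) <= 0.

(** The factors [c] make the recursion in these variables free of [c]. The matrix [r k] collects
    what is known at time [k], so that [s k.+1 = e k.+1 - r k]. *)
Let l k : 'M[R]_(N, p) := J *m Lam k - Ls.
Let g k : 'M[R]_(N, p) := c *: (J *m D k).
Let a k : 'M[R]_(N, p) := Lam k - J *m Lam k.
Let e k : 'M[R]_(N, p) := c *: (D k - J *m D k).
Let s k : 'M[R]_(N, p) := c *: (Y k - J *m D k - Ys).
Let r k : 'M[R]_(N, p) := W *m e k - s k.
Let rho k : 'M[R]_(N, p) := G *m r k.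
Let b k : 'M[R]_(N, p) := a k + W *m a k.

Let Je k : J *m e k = 0.
Proof. by rewrite -scalemxAr mulmxBr mulmxA avgmx_idem subrr scaler0. Qed.

Let Ja k : J *m a k = 0.
Proof. by rewrite mulmxBr mulmxA avgmx_idem subrr. Qed.

Let Js k : J *m s k = 0.
Proof.
rewrite -scalemxAr !mulmxBr (mulmxA J J) avgmx_idem JYs avg_tracking mulmxBr.
mx_ring.
Qed.

Let Jr k : J *m r k = 0.
Proof. by rewrite mulmxBr mulmxA JW Je Js subrr. Qed.

Let lS k : l k.+1 = l k + g k.+1.
Proof.
rewrite /l /g LamS mulmxDr mulmxA JW -scalemxAr; mx_ring.
Qed.

Let aS k : a k.+1 = W *m a k + e k.+1.
Proof.
rewrite /a /e LamS !mulmxDr mulmxA JW mulmxN (mulmxA W J) WJ -scalemxAr.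
mx_ring.
Qed.

Let eS k : e k.+1 = W *m e k + s k.+1 - s k.
Proof.
rewrite /e /s -scalemxAr mulmxBr (mulmxA W J) WJ DS; mx_ring.
Qed.

Let sS k : s k.+1 = e k.+1 - r k.
Proof. by rewrite eS /r; mx_ring. Qed.

Let rhoS k : rho k.+1 = rho k - e k.+1.
Proof.
rewrite -[e k.+1 in RHS](laplacian_inv_sub (Je k.+1)) -mulmxBr.
congr (G *m _).
rewrite /r sS /r; mx_ring.
Qed.

Let ip_avg0 (u v : 'M[R]_(N, p)) : J *m u = 0 -> ip u (J *m v) = 0.
Proof. by move=> Ju; rewrite -tr_avgmx -ip_mulmxl Ju /ip mul0mx mxtrace0. Qed.

(** This is [c] times [saddle_mono], split along the orthogonal projection [J]: [l] and [g] lie in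
    its range, [a] and [s] in its kernel, so the cross terms vanish. *)
Let mono k : ip (l k.+1) (g k.+1) + ip (a k.+1) (s k.+1) <= 0.
Proof.
have -> : ip (l k.+1) (g k.+1) + ip (a k.+1) (s k.+1) =
    c * ip (Lam k.+1 - Ls) (Y k.+1 - Ys).
  have -> : Lam k.+1 - Ls = l k.+1 + a k.+1 by rewrite /l /a; mx_ring.
  rewrite -ipZr (_ : c *: _ = s k.+1 + g k.+1); last by rewrite /s /g; mx_ring.
  rewrite (ipDl (l k.+1) (a k.+1)) !(ipDr _ (s k.+1) (g k.+1)).
  have -> : ip (l k.+1) (s k.+1) = 0.
    rewrite ipC /l (_ : J *m _ - Ls = J *m (Lam k.+1 - Ls)) ?ip_avg0 //.
    by rewrite mulmxBr JLs.
  have -> : ip (a k.+1) (g k.+1) = 0 by rewrite ipZr ip_avg0 // mulr0.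
  by rewrite add0r addr0.
by rewrite mulr_ge0_le0 // ltW.
Qed.

Let lyap k : R := ip (l k) (l k) + storage W (rho k) (a k).

(** The step [l k.+1 = l k + g k.+1] accounts for the mean part and [storage_step] for the consensus
    part; [mono] bounds the sum of the two pairings that appear. *)
Let lyapS k : lyap k.+1 + ip (g k.+1) (g k.+1) + ip (e k.+1) (W *m e k.+1)
  + (ip (b k) (b k) - ip (b k) (W *m b k)) <= lyap k.
Proof.
have := storage_step W_sym (rho k) (a k) (e k.+1).
rewrite -aS -rhoS laplacian_invP ?Jr // -sS -/(b k) => St.
have lE : ip (l k) (l k) = ip (l k.+1) (l k.+1) - 2 * ip (l k.+1) (g k.+1)
    + ip (g k.+1) (g k.+1).
  have -> : l k = l k.+1 - g k.+1 by rewrite lS; mx_ring.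
  by move: (l k.+1) (g k.+1) => u v; rewrite !ip_linear (ipC v u); ring.
have := mono k; move: St => /=; rewrite /lyap lE; lra.
Qed.

Let dir_ge0 k : 0 <= ip (b k) (b k) - ip (b k) (W *m b k).
Proof. by rewrite subr_ge0 dirichlet_ge0. Qed.

Let lyap_le k : lyap k.+1 <= lyap k.
Proof.
have := lyapS k; have := ip_ge0 (g k.+1); have := W_psd (e k.+1).
have := dir_ge0 k; lra.
Qed.

Let lyap_ge k : ip (l k) (l k) <= lyap k.
Proof.
rewrite lerDl; apply: le_trans (storage_ge W_sym W_row W_ge0 W_psd _ _).
exact: ip_ge0.
Qed.

Let lyap_cvg : exists L : R, lyap @ \oo --> L.
Proof.
exists (limn lyap); apply: nonincreasing_is_cvgn.
  by apply/nonincreasing_seqP.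
by exists 0 => _ [k _ <-]; apply: le_trans (lyap_ge k); exact: ip_ge0.
Qed.

(** This keeps the mean multipliers in a compact box when a limit point is extracted. *)
Lemma avg_dual_bounded : exists M : R, forall k,
  ip (J *m Lam k - Ls) (J *m Lam k - Ls) <= M.
Proof.
exists (lyap 0%N) => k; apply: le_trans (lyap_ge k) _; elim: k => // k; exact: le_trans.
Qed.

Let drop_cvg : (fun k => lyap k - lyap k.+1) @ \oo --> (0 : R).
Proof.
have [L cL] := lyap_cvg.
have cL1 : (fun k => lyap k.+1) @ \oo --> L by rewrite cvg_shiftS.
by apply: (cvg_eq (cvgB cL cL1)); rewrite ?subrr.
Qed.

Let drop_ge k : ip (g k.+1) (g k.+1) <= lyap k - lyap k.+1 /\
  ip (b k) (b k) - ip (b k) (W *m b k) <= lyap k - lyap k.+1.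
Proof.
have := lyapS k; have := ip_ge0 (g k.+1); have := W_psd (e k.+1).
have := dir_ge0 k; split; lra.
Qed.

Lemma avg_vanishes i h : (fun k => (J *m D k) i h) @ \oo --> (0 : R).
Proof.
rewrite -cvg_shiftS; apply: (cvg0_sqr_le (t := c ^+ 2) _ _ drop_cvg).
  exact: exprn_gt0.
move=> k; apply: le_trans (proj1 (drop_ge k)).
by have := sqr_le_ip (g k.+1) i h; rewrite {1}/g entryE exprMn.
Qed.

Let a_vanishes i h : (fun k => a k i h) @ \oo --> (0 : R).
Proof.
have cb j q : (fun k => b k j q) @ \oo --> (0 : R).
  move: j q; apply: (consensus_of_dirichlet W_sym W_row W_ge0 E_conn W_pos).
    by move=> k; rewrite mulmxDr mulmxA JW Ja addr0.
  apply: squeeze_cvgr drop_cvg; last exact: cvg_cst.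
  by apply: nearW => k; rewrite dir_ge0 (proj2 (drop_ge k)).
move: i h; apply: cvg_entry0.
have cbb : (fun k => ip (b k) (b k)) @ \oo --> (0 : R) by exact: cvg_ip0.
apply: squeeze_cvgr cbb; last exact: cvg_cst.
apply: nearW => k; rewrite ip_ge0 /=.
(* Semidefiniteness makes the cross term of [ip (b k) (b k)] nonnegative, so [b] dominates [a]. *)
rewrite /b (ipDl (a k) (W *m a k)) !(ipDr _ (a k) (W *m a k)) (ipC (W *m a k) (a k)).
have := W_psd (a k); have := ip_ge0 (W *m a k); lra.
Qed.

Lemma dual_consensus i h : (fun k => (Lam k - J *m Lam k) i h) @ \oo --> (0 : R).
Proof. exact: a_vanishes. Qed.

Let Wa_vanishes i h : (fun k => (W *m a k) i h) @ \oo --> (0 : R).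
Proof.
exact: cvg_mulmx_entry0 a_vanishes _ _.
Qed.

Let e_vanishes i h : (fun k => e k i h) @ \oo --> (0 : R).
Proof.
rewrite -cvg_shiftS.
have ca : (fun k => a k.+1 i h) @ \oo --> (0 : R) by have := @a_vanishes i h; rewrite -cvg_shiftS.
apply: (cvg_eq (cvgB ca (@Wa_vanishes i h))); rewrite ?subrr // => k.
rewrite -[RHS]/(e k.+1 i h).
have -> : e k.+1 = a k.+1 - W *m a k by rewrite aS; mx_ring.
by rewrite (addmx_entry (a k.+1)) oppmx_entry.
Qed.

Lemma tracking_consensus i h :
  (fun k => (D k - J *m D k) i h) @ \oo --> (0 : R).
Proof.
apply: (cvg_eq (cvgMl_tmp (a := c^-1) (e_vanishes i h))); rewrite ?mulr0 // => k.
by rewrite /e (scalemx_entry c) mulKf // gt_eqF.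
Qed.

(** The Lyapunov function converges, and it differs from this expression by a vanishing amount,
    because the consensus errors [a] and [e] tend to zero. *)
Lemma fejer_cvg : exists L : R,
  (fun k => ip (J *m Lam k - Ls) (J *m Lam k - Ls)
    + c ^+ 2 * ip (G *m (Y k - J *m D k - Ys)) (G *m (Y k - J *m D k - Ys)))
  @ \oo --> L.
Proof.
have [L cL] := lyap_cvg; exists L.
(* Here [w k - h k] equals [G *m s k]. The vanishing part is [w], and [h] is bounded by
   [storage_ge], so [ip (h k) (w k)] tends to zero. *)
pose h k : 'M[R]_(N, p) := rho k + W *m a k.
pose w k : 'M[R]_(N, p) := G *m (W *m e k) + W *m a k.
have cw i q : (fun k => w k i q) @ \oo --> (0 : R).
  have cGWe : (fun k => (G *m (W *m e k)) i q) @ \oo --> (0 : R).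
    exact: cvg_mulmx_entry0 (cvg_mulmx_entry0 W e_vanishes) _ _.
  apply: (cvg_eq (cvgD cGWe (@Wa_vanishes i q))); rewrite ?addr0 // => k.
  by rewrite /w entryE.
have hM k : ip (h k) (h k) <= lyap 0%N.
  apply: (@le_trans _ _ (lyap k)).
    apply: le_trans (storage_ge W_sym W_row W_ge0 W_psd _ _) _.
    by rewrite lerDr ip_ge0.
  by elim: k => // k; exact: le_trans.
have chw : (fun k => ip (h k) (w k)) @ \oo --> (0 : R).
  exact: cvg_ip0_bounded hM cw.
have cww : (fun k => ip (w k) (w k)) @ \oo --> (0 : R) by exact: cvg_ip0.
have caa : (fun k => ip (a k) (a k)) @ \oo --> (0 : R) by exact: cvg_ip0.
have caW : (fun k => ip (a k) (W *m a k)) @ \oo --> (0 : R) by exact: cvg_ip0.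
have cWW : (fun k => ip (W *m a k) (W *m a k)) @ \oo --> (0 : R) by exact: cvg_ip0.
apply: (cvg_eq (cvgD (cvgD cL (cvgB cWW (cvgD caa caW)))
  (cvgB cww (cvgMl_tmp (a := 2) chw)))); last first.
  by rewrite addr0 mulr0 !subrr !addr0.
move=> k.
have <- : ip (w k - h k) (w k - h k) =
    c ^+ 2 * ip (G *m (Y k - J *m D k - Ys)) (G *m (Y k - J *m D k - Ys)).
  have -> : w k - h k = c *: (G *m (Y k - J *m D k - Ys)).
    rewrite scalemxAr -/(s k) /w /h /rho /r (mulmxBr G (W *m e k)); mx_ring.
  by rewrite ipZl ipZr mulrA -expr2.
rewrite -/(l k).
transitivity (lyap k + (ip (W *m a k) (W *m a k) - (ip (a k) (a k) + ip (a k) (W *m a k)))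
  + (ip (w k) (w k) - 2 * ip (h k) (w k))) => //.
have -> : lyap k = ip (l k) (l k) + (ip (h k) (h k) - ip (W *m a k) (W *m a k)
    + ip (a k) (a k) + ip (a k) (W *m a k)).
  rewrite /lyap /storage /h; move: (rho k) (W *m a k) => u v.
  by rewrite !(ipDl u v) !(ipDr _ u v) (ipC v u); ring.
move: (w k) (h k) => u v.
by rewrite !(ipDl u) !(ipDr _ u) !ipNl !ipNr (ipC v u); ring.
Qed.

End Tracking.

(** * Convexity and strong duality *)

Section EuclideanVectors.
Context {R : realType} {m : nat}.
Implicit Types u v : 'cV[R]_m.

Lemma dotvE u v : dotv u v = ip u v.
Proof.
rewrite /dotv ipE mxE; apply: eq_bigr => i _.
by rewrite big_ord1 mxE.
Qed.

Lemma sqr_enormE v : enorm v ^+ 2 = ip v v.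
Proof.
rewrite sqr_sqrtr; last by apply: sumr_ge0 => i _; rewrite sqr_ge0.
by rewrite ipE; apply: eq_bigr => i _; rewrite big_ord1 expr2.
Qed.

Lemma ip_segment u v (t : R) :
  ip (u + t *: v) (u + t *: v) = ip u u + 2 * t * ip u v + t ^+ 2 * ip v v.
Proof. by rewrite !ip_linear (ipC v u); ring. Qed.

End EuclideanVectors.

Lemma continuous_sqr_norm (R : realType) (q : nat) (T' : topologicalType) (u : T' -> 'cV[R]_q) x :
  (forall j, {for x, continuous (fun y => u y j 0)}) ->
  {for x, continuous (fun y => ip (u y) (u y))}.
Proof.
move=> cu; have FF : Filter (nbhs x) := nbhs_filter x.
have E y : \sum_j u y j 0 * u y j 0 = ip (u y) (u y).
  by rewrite ipE; apply: eq_bigr => j _; rewrite big_ord1.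
suff H : (fun y => \sum_j u y j 0 * u y j 0) @ x --> \sum_j u x j 0 * u x j 0.
  exact: (cvg_eq H E (E x)).
by apply: cvg_sumr => j _; apply: cvgM; exact: cu.
Qed.

(** * Continuity of finite convex functions *)

Section Convexity.
Context {R : realType} {n : nat}.

Lemma convex_functionP (f : 'cV[R]_n -> R) : convex_function setT f ->
  forall x y (t : R), 0 <= t -> t <= 1 ->
  f (t *: x + (1 - t) *: y) <= t * f x + (1 - t) * f y.
Proof. by move=> cf x y t t0 t1; apply: (cf (Itv01 t0 t1)); rewrite inE. Qed.

Lemma convex_setP (X : set 'cV[R]_n) : convex_set X ->
  forall x y (t : R), X x -> X y -> 0 <= t -> t <= 1 ->
  X (t *: x + (1 - t) *: y).
Proof.
move=> cX x y t Xx Xy t0 t1.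
by have /set_mem := cX x y (Itv01 t0 t1) (mem_set Xx) (mem_set Xy).
Qed.

(* One coordinate at a time: [x + (h_i v + w)] is the midpoint of [x + 2 h_i v]
   and [x + 2 w]. *)
Lemma convex_upper (f : 'cV[R]_n -> R) (x : 'cV[R]_n) (e : R) :
  convex_function setT f -> 0 < e ->
  exists2 d, 0 < d & forall h : 'cV[R]_n,
    (forall i, `|h i 0| < d) -> f (x + h) <= f x + e.
Proof.
move=> /convex_functionP cf e0.
suff key (r : seq 'I_n) e' : 0 < e' -> exists2 d, 0 < d &
    forall h : 'cV[R]_n, (forall i, `|h i 0| < d) ->
      f (x + \sum_(i <- r) h i 0 *: delta_mx i 0) <= f x + e'.
  have [d d0 dP] := key (index_enum 'I_n) _ e0; exists d => // h hd.
  rewrite {1}[h]matrix_sum_delta; under eq_bigr do rewrite big_ord1.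
  exact: dP.
elim: r e' => [|i r IH] e' e'0.
  by exists 1 => // h _; rewrite big_nil addr0 lerDl ltW.
have [d d0 dP] := IH _ e'0.
set v : 'cV[R]_n := delta_mx i 0.
(* [M] dominates the increments of [f] at [x] in both directions of the new coordinate; the summand
   1 keeps it positive for the division below. *)
set M := `|f (x + v) - f x| + `|f (x - v) - f x| + 1.
have M0 : 0 < M by rewrite ltr_wpDl // addr_ge0.
have one (s : R) : `|s| <= 1 -> f (x + s *: v) <= f x + `|s| * M.
  move=> s1.
  have [s0|s0] := lerP 0 s.
    rewrite ger0_norm // in s1 *.
    have -> : x + s *: v = s *: (x + v) + (1 - s) *: x by mx_ring.
    apply: (le_trans (cf _ _ _ s0 s1)).
    have : f (x + v) - f x <= M.
      by rewrite /M -addrA (le_trans (ler_norm _)) // lerDl addr_ge0.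
    by move=> /(ler_wpM2l s0); lra.
  rewrite ltr0_norm // in s1 *.
  have Ns0 : 0 <= - s by rewrite oppr_ge0 ltW.
  have -> : x + s *: v = (- s) *: (x - v) + (1 - - s) *: x by mx_ring.
  apply: (le_trans (cf _ _ _ Ns0 s1)).
  have : f (x - v) - f x <= M.
    have := ler_norm (f (x - v) - f x); have := normr_ge0 (f (x + v) - f x).
    by rewrite /M; lra.
  by move=> /(ler_wpM2l Ns0); lra.
(* The midpoint doubles both displacements: [d / 2] keeps [2 *: w] within reach of the induction
   hypothesis, [2^-1] makes [one] applicable to [2 * h i 0], and the last bound makes its error at
   most [e']. *)
exists (Num.min (d / 2) (Num.min (2^-1) (e' / M / 2))).
  have em0 : 0 < e' / M / 2 by rewrite !divr_gt0.
  have d20 : 0 < d / 2 by rewrite divr_gt0.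
  by rewrite !lt_min d20 em0 invr_gt0 ltr0n.
move=> h hd; rewrite big_cons.
set w := \sum_(j <- r) _.
have -> : x + (h i 0 *: v + w) = 2^-1 *: (x + (2 * h i 0) *: v)
    + (1 - 2^-1) *: (x + 2 *: w).
  by apply/matrixP => j q; rewrite ?entryE; field.
have h2 : 0 <= 2^-1 :> R by rewrite invr_ge0.
have h21 : 2^-1 <= 1 :> R by rewrite invf_le1 // ler1n.
apply: (le_trans (cf _ _ _ h2 h21)).
have wd : f (x + 2 *: w) <= f x + e'.
  rewrite /w scaler_sumr.
  under eq_bigr => j _ do rewrite scalerA -[2 * h j 0]scalemx_entry.
  apply: dP => j; rewrite entryE normrM ger0_norm // mulrC -ltr_pdivlMr //.
  by have := hd j; rewrite lt_min => /andP[].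
have := hd i; rewrite !lt_min => /and3P[_ hi1 hi2].
have n2 : `|2 * h i 0| = 2 * `|h i 0| by rewrite normrM ger0_norm.
have vd : f (x + (2 * h i 0) *: v) <= f x + e'.
  apply: le_trans (one _ _) _; first by rewrite n2; lra.
  rewrite lerD2l -ler_pdivlMr // n2; lra.
lra.
Qed.

(** The lower bound comes from the upper one by reflection: [x] is the midpoint of [y] and
    [x - (y - x)]. *)
Lemma convex_continuous (f : 'cV[R]_n -> R) :
  convex_function setT f -> continuous f.
Proof.
move=> cf x; apply: (proj2 (@cvgrPdistC_lt _ _ _ (nbhs x) (nbhs_filter x) f (f x))).
move=> e e0.
have e20 : 0 < e / 2 by rewrite divr_gt0.
have [d d0 dP] := convex_upper x cf e20.
apply/nbhs_ballP; exists d => // y [_ yd].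
have hd i : `|(y - x) i 0| < d.
  by have := yd i 0; rewrite -ball_normE /= distrC !entryE.
have up := dP _ hd; rewrite subrKC in up.
have lo : f (x - (y - x)) <= f x + e / 2.
  by apply: dP => i; rewrite (oppmx_entry (y - x)) normrN.
have mid : f x <= 2^-1 * f y + (1 - 2^-1) * f (x - (y - x)).
  rewrite {1}(_ : x = 2^-1 *: y + (1 - 2^-1) *: (x - (y - x))).
    by apply: (convex_functionP cf); rewrite ?invr_ge0 ?invf_le1 ?ler1n.
  by apply/matrixP => j q; rewrite ?entryE; field.
by rewrite ltr_norml; apply/andP; split; lra.
Qed.

End Convexity.

(** Applied along a segment leaving a minimizer, where [a] is the linear part and [b] comes from the
    quadratic term. *)
Lemma first_order_condition (R : realFieldType) (a b : R) :
  (forall t, 0 < t -> t <= 1 -> 0 <= t * a + t ^+ 2 * b) -> 0 <= a.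
Proof.
move=> tab; rewrite leNgt; apply/negP => a0.
have b0 : 0 <= `|b| by [].
(* This [t] lies in [(0, 1]] when [a < 0], and it satisfies [t * |b| < - a], so that [a + t * b]
   would be negative. *)
set t := - a / (`|b| + - a + 1).
have den : 0 < `|b| + - a + 1 by lra.
have t0 : 0 < t by rewrite divr_gt0 ?oppr_gt0.
have t1 : t <= 1 by rewrite ler_pdivrMr // mul1r; lra.
have := tab _ t0 t1; rewrite expr2 -mulrA -mulrDr pmulr_rge0 // => ab.
have tden : t * (`|b| + - a + 1) = - a by rewrite divfK // gt_eqF.
have tb : t * b <= t * `|b| by rewrite ler_pM2l // ler_norm.
have : 0 < t * (1 - a) by rewrite mulr_gt0 //; lra.
by move: tden; rewrite !mulrDr mulr1 mulrN; lra.
Qed.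

(** The bound starts at index 1 because the optimality inequalities hold only for iterates produced
    by a minimization, not for the initial point. *)
Lemma near_le_of_cvg0 (R : realType) (u v : nat -> R) :
  (forall k, v k.+1 <= u k.+1) -> u @ \oo --> (0 : R) ->
  forall e, 0 < e -> \forall k \near \oo, v k <= e.
Proof.
move=> vu /cvgrPdistC_le cu e /cu H.
apply: filterS2 H (nbhs_infty_gt 0) => -[//|k] uk _.
by apply: le_trans (vu k) _; move: uk; rewrite subr0; exact: le_trans (ler_norm _).
Qed.

(** A cluster point replaces a convergent subsequence: every eventual upper bound on a continuous
    function passes to it, for all such functions at once. *)
Lemma compact_limit_point (R : realType) (T : topologicalType) (K : set T)
    (u : nat -> T) : compact K -> (forall k, K (u k)) ->
  exists2 x, K x & forall g : T -> R, {for x, continuous g} ->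
    (forall e, 0 < e -> \forall k \near \oo, g (u k) <= e) -> g x <= 0.
Proof.
move=> cK uK.
have uinK : (u @ \oo) K by exists 0%N => // k _; exact: uK.
have [x [Kx clx]] := cK (u @ \oo) _ uinK.
exists x => // g cg gle; rewrite leNgt; apply/negP => gx0.
have g20 : 0 < g x / 2 by rewrite divr_gt0.
have near_x : \forall y \near x, g x / 2 < g y.
  have /cvgrPdistC_lt/(_ _ g20) := cg; apply: filterS => y.
  by rewrite ltr_norml => /andP[]; lra.
have [y [gy]] := clx _ _ (gle _ g20 : (u @ \oo) [set y | g y <= g x / 2]) near_x.
by rewrite ltNge gy.
Qed.

(** * Strong duality by a quadratic penalty *)

Section Duality.
Context {R : realType} {N p : nat} {n : 'I_N -> nat}.
Variables (f : forall i, 'cV[R]_(n i) -> R) (X : forall i, set 'cV[R]_(n i)).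
Variable A : forall i, 'M[R]_(p, n i).
Variables (b : 'cV[R]_p) (bs : 'I_N -> 'cV[R]_p).
Hypothesis hbs : \sum_i bs i = b.
Hypothesis f_convex : forall i, convex_function setT (@f i).
Hypothesis X_convex : forall i, convex_set (@X i).
Hypothesis X_compact : forall i, compact (@X i).

Local Notation T := (prod_topology (fun i => 'cV[R]_(n i))).
Local Notation K := [set y : T | forall i, X (y i)].

Definition residual (y : T) : 'cV[R]_p := \sum_i A i *m y i - b.

Lemma profiles_compact : compact K.
Proof. exact: tychonoff. Qed.

Lemma coord_cvg (y : T) i j :
  (fun z : T => z i j 0) @ y --> (y i j 0 : R).
Proof.
exact: (cvg_comp _ _ (@proj_continuous _ _ i y) (@coord_continuous _ _ _ j 0 (y i))).
Qed.

Lemma total_cost_continuous : continuous (fun y : T => \sum_i f (y i)).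
Proof.
move=> y; apply: (@cvg_sumr _ _ _ (nbhs_filter y)) => i _.
apply: (@cvg_comp _ _ _ (fun z : T => z i) (@f i) _ (nbhs (y i))).
  exact: (@proj_continuous _ _ i y).
exact: convex_continuous.
Qed.

Lemma residual_entry_continuous j :
  continuous (fun y : T => residual y j 0).
Proof.
move=> y; have FF : Filter (nbhs y) := nbhs_filter y.
have E (z : T) : \sum_i \sum_h A i j h * z i h 0 - b j 0 =
    residual z j 0.
  rewrite /residual !entryE summxE; congr (_ - _).
  by apply: eq_bigr => i _; rewrite mxE.
suff H : (fun z : T => \sum_i \sum_h A i j h * z i h 0 - b j 0) @ y -->
    \sum_i \sum_h A i j h * y i h 0 - b j 0 by exact: (cvg_eq H E (E y)).
apply: cvgB; last exact: cvg_cst.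
apply: cvg_sumr => i _; apply: cvg_sumr => h _.
by apply: cvgMl_tmp; exact: coord_cvg.
Qed.

(** Continuity and compactness make the minimum attained, so the default value in [min_value] does
    not occur. *)
Lemma dual_funP i (l : 'cV[R]_p) : @X i !=set0 ->
  exists y, [/\ X y, dual_fun f X A bs i l = f y + dotv l (A i *m y - bs i)
   & forall y', X y' -> dual_fun f X A bs i l <= f y' + dotv l (A i *m y' - bs i)].
Proof.
move=> X0; set g := fun y => f y + dotv l (A i *m y - bs i).
have cg : continuous g.
  move=> y; have FF : Filter (nbhs y) := nbhs_filter y.
  apply: cvgD; first exact: convex_continuous.
  have E (z : 'cV[R]_(n i)) : \sum_j l j 0 * (\sum_h A i j h * z h 0 - bs i j 0) =
      dotv l (A i *m z - bs i).
    rewrite dotvE ipE; apply: eq_bigr => j _; rewrite big_ord1 !entryE.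
    by rewrite [in RHS]mxE.
  suff H : (fun z : 'cV[R]_(n i) => \sum_j l j 0 * (\sum_h A i j h * z h 0 - bs i j 0)) @ y -->
      \sum_j l j 0 * (\sum_h A i j h * y h 0 - bs i j 0).
    exact: (cvg_eq H E (E y)).
  apply: cvg_sumr => j _; apply: cvgMl_tmp.
  apply: cvgB; last exact: cvg_cst.
  by apply: cvg_sumr => h _; apply: cvgMl_tmp; exact: coord_continuous.
have [y /set_mem Xy ymin] :=
  compact_EVT_min X0 (@X_compact i) (continuous_subspaceT cg).
have : exists v, (g @` argmin (@X i) g) v.
  by exists (g y), y => //; split=> // z Xz; apply: ymin; exact: mem_set.
move=> /(xgetPex 0)[z [Xz zmin] vE].
by exists z; split => // y' /zmin; rewrite /dual_fun /min_value -vE.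
Qed.

Lemma residual_split (l : 'cV[R]_p) (y : T) :
  \sum_i dotv l (A i *m y i - bs i) = dotv l (residual y).
Proof.
rewrite /residual -hbs -sumrB dotvE ipE exchange_big /=.
under eq_bigr => i _ do rewrite dotvE ipE exchange_big /=.
rewrite exchange_big /=; apply: eq_bigr => h _.
rewrite exchange_big /=; apply: eq_bigr => j _.
by rewrite summxE mulr_sumr.
Qed.

Lemma weak_duality (l : 'cV[R]_p) (y : T) : K y ->
  \sum_i dual_fun f X A bs i l <=
  \sum_i f (y i) + dotv l (residual y).
Proof.
move=> Ky.
rewrite -residual_split -big_split /=; apply: ler_sum => i _.
have [|_ [_ _]] := @dual_funP i l; first by exists (y i); exact: Ky.
by apply; exact: Ky.
Qed.

(** The Lagrangian separates over the agents, so minimizers are chosen one agent at a time; [y]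
    witnesses that the sets are nonempty. *)
Lemma dual_attained (l : 'cV[R]_p) (y : T) : K y ->
  exists2 z : T, K z & \sum_i dual_fun f X A bs i l =
    \sum_i f (z i) + dotv l (residual z).
Proof.
move=> Ky.
have zP i : {z | X z /\ dual_fun f X A bs i l = f z + dotv l (A i *m z - bs i)}.
  apply: cid; have [|z [Xz zE _]] := @dual_funP i l; last by exists z.
  by exists (y i); exact: Ky.
exists (fun i => sval (zP i)) => [i|]; first by case: (svalP (zP i)).
rewrite -residual_split -big_split /=; apply: eq_bigr => i _.
by case: (svalP (zP i)).
Qed.

(** Take [y] minimizing the penalized cost over the compact set of profiles. The gradient of the
    penalty acts as the multiplier [k *: residual y], so the first-order condition bounds the cost
    of [y] by the dual value there. Comparison with the feasible [xs] gives the last bound. *)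
Lemma penalty_minimizer (k : R) xs : 0 <= k -> primal_optimal f X A b xs ->
  exists y : T, [/\ K y,
    \sum_i f (y i) <= \sum_i dual_fun f X A bs i (k *: residual y) &
    \sum_i f (y i) + k / 2 * ip (residual y) (residual y) <= \sum_i f (xs i)].
Proof.
move=> k0 [[xs_b Xxs] _].
set P := fun y : T => \sum_i f (y i) + k / 2 * ip (residual y) (residual y).
have cP : continuous P.
  move=> y; have FF : Filter (nbhs y) := nbhs_filter y.
  apply: (@cvgD _ _ _ (nbhs y)); first exact: total_cost_continuous.
  apply: (@cvgMl_tmp _ _ (nbhs y)); apply: continuous_sqr_norm => j.
  exact: residual_entry_continuous.
have [|y /set_mem Ky ymin] :=
  compact_EVT_min _ profiles_compact (continuous_subspaceT cP).
  by exists xs.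
have {}ymin y' : K y' -> P y <= P y' by move=> Ky'; apply/ymin/mem_set.
exists y; split => //; last first.
  apply: le_trans (ymin xs Xxs) _.
  by rewrite /P /residual xs_b subrr /ip mul0mx mxtrace0 mulr0 addr0.
have [z Kz ->] := dual_attained (k *: residual y) Ky.
set r := residual y; rewrite -/(residual z); set w := residual z - r.
rewrite dotvE -subr_ge0.
(* The middle quantity is the directional first-order term at [y] towards [z]; the pairing with
   [residual z] exceeds it by [k * ip r r]. *)
apply: (@le_trans _ _ (\sum_i f (z i) - \sum_i f (y i) + k * ip r w)).
  apply: (@first_order_condition _ _ (k / 2 * ip w w)) => t t0 t1.
  pose q : T := fun i => t *: z i + (1 - t) *: y i.
  have Kq : K q by move=> i; apply: convex_setP => //; exact: ltW.
  have fq : \sum_i f (q i) <= t * \sum_i f (z i) + (1 - t) * \sum_i f (y i).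
    rewrite !mulr_sumr -big_split /=; apply: ler_sum => i _.
    by apply: convex_functionP => //; exact: ltW.
  have rq : residual q = r + t *: w.
    rewrite /w /r /residual /q.
    under eq_bigr do rewrite mulmxDr -!scalemxAr.
    by rewrite big_split /= -!scaler_sumr; mx_ring.
  have := ymin q Kq; rewrite /P rq ip_segment -/r => yq.
  move: fq yq; set Fq := \sum_i f (q i); set Fy := \sum_i f (y i).
  set Fz := \sum_i f (z i) => fq yq.
  suff -> : t * (Fz - Fy + k * ip r w) + t ^+ 2 * (k / 2 * ip w w) =
    (t * Fz + (1 - t) * Fy + k / 2 * (ip r r + 2 * t * ip r w + t ^+ 2 * ip w w))
    - (Fy + k / 2 * ip r r) by lra.
  by field.
have -> : residual z = w + r by rewrite /w; mx_ring.
rewrite ipZl ipDr mulrDr; have := mulr_ge0 k0 (ip_ge0 r); lra.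
Qed.

(** Let the penalty weight [k.+1] grow. The minimizers cost at most a dual value, hence at most the
    dual optimum, and this passes to a limit point [y]. The penalty forces [y] to be feasible, so
    its cost is at least the primal optimum. *)
Lemma primal_le_dual xs ls :
  primal_optimal f X A b xs -> dual_optimal f X A bs ls ->
  \sum_i f (xs i) <= \sum_i dual_fun f X A bs i ls.
Proof.
move=> xsP [_ lsP].
have yP k : {y : T | [/\ K y,
    \sum_i f (y i) <= \sum_i dual_fun f X A bs i (k.+1%:R *: residual y) &
    \sum_i f (y i) + k.+1%:R / 2 * ip (residual y) (residual y)
      <= \sum_i f (xs i)]}.
  by apply: cid; exact: penalty_minimizer.
pose u k := sval (yP k).
have Ku k : K (u k) by case: (svalP (yP k)).
have [y Ky ylim] := @compact_limit_point R _ _ _ profiles_compact Ku.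
have fy : \sum_i f (y i) <= \sum_i dual_fun f X A bs i ls.
  rewrite -subr_le0; apply: (ylim (fun y : T => \sum_i f (y i) - _)).
    apply: (@cvgB _ _ _ (nbhs y)); first exact: total_cost_continuous.
    exact: cvg_cst.
  move=> e e0; apply: nearW => k; apply: le_trans (ltW e0); rewrite subr_le0.
  by case: (svalP (yP k)) => _ /le_trans le _; apply/le/lsP.
have [m _ mP] : exists2 m, K m & forall y', K y' -> \sum_i f (m i) <= \sum_i f (y' i).
  have [|m /set_mem Km mmin] := compact_EVT_min _ profiles_compact
    (continuous_subspaceT total_cost_continuous); first by exists y.
  by exists m => // y' Ky'; apply/mmin/mem_set.
have ry : residual y = 0.
  have : ip (residual y) (residual y) <= 0.
    apply: (ylim (fun y => ip (residual y) (residual y))).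
      by apply: continuous_sqr_norm => j; exact: residual_entry_continuous.
    move=> e e0.
    (* As no profile costs less than [m], [C] bounds the penalty term for every [k]; the squared
       residual is thus at most [2 * C / k.+1]. *)
    set C := \sum_i f (xs i) - \sum_i f (m i).
    have C0 : 0 <= C by rewrite subr_ge0 mP //; case: xsP => [[]].
    have [k0 k0P] : exists k0, forall k, (k0 <= k)%N -> 2 * C / e <= k.+1%:R.
      exists (Num.truncn (2 * C / e)) => k kk.
      have : 0 <= 2 * C / e by rewrite divr_ge0 ?mulr_ge0 // ltW.
      move=> /truncn_itv /andP[_ /ltW]; move=> /le_trans; apply.
      by rewrite ler_nat.
    exists k0 => // k /k0P; rewrite ler_pdivrMr // => kC.
    have [_ _ le] := svalP (yP k).
    have := mP _ (Ku k); rewrite -/(u k) in le.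
    move=> mk; rewrite leNgt; apply/negP => gte.
    move: le; rewrite -/(u k); have k2 : 0 < k.+1%:R / 2 :> R by rewrite divr_gt0.
    have := gte; rewrite -(ltr_pM2l k2) => gte2.
    rewrite /C in kC; lra.
  move=> r0; apply/matrixP => j h; rewrite [RHS]mxE; apply/eqP.
  rewrite -sqrf_eq0 eq_le sqr_ge0 andbT.
  exact: le_trans (sqr_le_ip _ _ _) r0.
apply: le_trans fy; apply: (proj2 xsP); split=> //.
by apply/eqP; rewrite -subr_eq0; apply/eqP.
Qed.

Lemma strong_duality xs ls (y : T) :
  primal_optimal f X A b xs -> dual_optimal f X A bs ls -> K y ->
  \sum_i f (xs i) <= \sum_i f (y i) + dotv ls (residual y).
Proof.
by move=> xsP lsP Ky; apply: le_trans (primal_le_dual xsP lsP) (weak_duality _ Ky).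
Qed.

End Duality.

(** * Convergence of the algorithm *)

Section AgentRows.
Context {R : realType} {N p : nat}.
Implicit Types u v : 'I_N -> 'cV[R]_p.

(** With agents as rows, the Kronecker product of [W] with the identity acts as left multiplication
    by [W]. *)
Definition rows u : 'M[R]_(N, p) := \matrix_(i, j) u i j 0.

Lemma rowsD u v : rows (fun i => u i + v i) = rows u + rows v.
Proof. by apply/matrixP => i j; rewrite !mxE. Qed.

Lemma rowsB u v : rows (fun i => u i - v i) = rows u - rows v.
Proof. by apply/matrixP => i j; rewrite !mxE. Qed.

Lemma rowsZ t u : rows (fun i => t *: u i) = t *: rows u.
Proof. by apply/matrixP => i j; rewrite !mxE. Qed.

Lemma ip_rows u v : ip (rows u) (rows v) = \sum_i dotv (u i) (v i).
Proof.
rewrite ipE; apply: eq_bigr => i _; rewrite dotvE ipE.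
by apply: eq_bigr => j _; rewrite big_ord1 !mxE.
Qed.

Lemma sqr_enorm_stackp v : enorm (stackp v) ^+ 2 = ip (rows v) (rows v).
Proof.
rewrite sqr_enormE -dotvE /dotv /stackp /stack tr_mxcol mul_mxrow_mxcol.
by rewrite ip_rows summxE.
Qed.

Lemma stackpB u v : stackp (fun i => u i - v i) = stackp u - stackp v.
Proof. by rewrite /stackp /stack -mxcolB. Qed.

Lemma consensus_errorE v : consensus_error v = stackp (fun i => v i - average v).
Proof. by rewrite stackpB. Qed.

Lemma avgmx_rows v : avgmx *m rows v = rows (fun=> average v).
Proof.
apply/matrixP => i j; rewrite !mxE summxE mulr_sumr.
by apply: eq_bigr => h _; rewrite !mxE.
Qed.

Lemma blkdiag_stack (n : 'I_N -> nat) (A : forall i, 'M[R]_(p, n i))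
    (y : forall i, 'cV[R]_(n i)) :
  blkdiag A *m stack y = stackp (fun i => A i *m y i).
Proof.
rewrite /blkdiag /stack mul_mxblock_mxrow /stackp /stack; apply: eq_mxcol => i.
rewrite (bigD1 i) //= eqxx big1 ?addr0 // => j /negPf ji.
by rewrite eq_sym ji mul0mx.
Qed.

Lemma mulmx_rows (E : rel 'I_N) (W : 'M[R]_N) v :
  (forall i j, ~~ E i j -> W i j = 0) ->
  W *m rows v = rows (local_mix E W v).
Proof.
move=> W_supp; apply/matrixP => i j; rewrite !mxE summxE.
rewrite (bigID (E i)) /= [X in _ + X]big1 ?addr0; last first.
  by move=> h /W_supp ->; rewrite mul0r.
by apply: eq_bigr => h _; rewrite !mxE.
Qed.

Lemma psdmx_ip (W : 'M[R]_N) (v : 'M[R]_(N, p)) :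
  psdmx W -> 0 <= ip v (W *m v).
Proof.
move=> [_ Wpos]; rewrite ipE exchange_big /=; apply: sumr_ge0 => j _.
have := Wpos (col j v); rewrite -mulmxA mxE.
congr (0 <= _); apply: eq_bigr => i _; rewrite !mxE; congr (_ * _).
by apply: eq_bigr => h _; rewrite !mxE.
Qed.

Lemma cvg_enorm0 (T : Type) (F : set_system T) {FF : Filter F} (q : nat)
    (u : T -> 'cV[R]_q) :
  (fun x => enorm (u x) ^+ 2) @ F --> (0 : R) -> (fun x => enorm (u x)) @ F --> (0 : R).
Proof. by move=> cu; apply: (cvg0_sqr_le ltr01 _ cu) => x; rewrite mul1r. Qed.

Lemma avgmx_rows_const (l : 'cV[R]_p) : avgmx *m rows (fun=> l) = rows (fun=> l).
Proof.
apply/matrixP => i j; rewrite !mxE.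
under eq_bigr do rewrite !mxE.
rewrite sumr_const card_ord -mulrnAl -(mulr_natr N%:R^-1) mulVf ?mul1r //.
by rewrite pnatr_eq0 -lt0n; apply: leq_ltn_trans (leq0n i) (ltn_ord i).
Qed.

Lemma consensus_cvg0 (v : nat -> 'I_N -> 'cV[R]_p) :
  (forall i h, (fun k => (rows (v k) - avgmx *m rows (v k)) i h) @ \oo --> (0 : R)) ->
  (fun k => enorm (consensus_error (v k))) @ \oo --> (0 : R).
Proof.
move=> cv; apply: cvg_enorm0.
under eq_fun do rewrite consensus_errorE sqr_enorm_stackp rowsB -avgmx_rows.
exact: cvg_ip0.
Qed.

End AgentRows.

(** * Optimality condition of the local minimization *)

Section Optimality.
Context {R : realType} {p n : nat}.
Variables (f : 'cV[R]_n -> R) (X : set 'cV[R]_n) (A : 'M[R]_(p, n)).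
Hypothesis f_convex : convex_function setT f.
Hypothesis X_convex : convex_set X.

(** The gradient of the quadratic term at the minimizer is absorbed into the multiplier [m], which
    in the algorithm is the updated [lam k.+1 i]. The first-order condition along segments of [X]
    gives the rest. *)
Lemma augmented_argmin (c : R) (l w : 'cV[R]_p) x :
  argmin X (fun y => f y + dotv l (A *m y) + c / 2 * enorm (A *m y + w) ^+ 2) x ->
  let m := l + c *: (A *m x + w) in
  forall y, X y -> f x + dotv m (A *m x) <= f y + dotv m (A *m y).
Proof.
move=> [Xx xmin] m y Xy; set v := A *m (y - x).
set r := A *m x + w.
rewrite -subr_ge0.
apply: (@le_trans _ _ (f y - f x + ip l v + c * ip r v)); last first.
  rewrite !dotvE /m -/r /v mulmxBr !ip_linear; lra.
apply: (@first_order_condition _ _ (c / 2 * ip v v)) => t t0 t1.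
set q := t *: y + (1 - t) *: x.
have fq : f q <= t * f y + (1 - t) * f x.
  by apply: convex_functionP => //; exact: ltW.
have /xmin : X q by apply: convex_setP => //; exact: ltW.
have Aq : A *m q = A *m x + t *: v.
  by rewrite /q /v mulmxDr mulmxBr -!scalemxAr; mx_ring.
rewrite Aq !dotvE !sqr_enormE -/r.
have -> : A *m x + t *: v + w = r + t *: v by rewrite /r; mx_ring.
rewrite ip_segment (ipDr l) (ipZr t l) => xq.
move: fq xq; set fq := f q; set fy := f y; set fx := f x.
set lx := ip l (A *m x); set lv := ip l v.
suff -> : t * (fy - fx + lv + c * ip r v) + t ^+ 2 * (c / 2 * ip v v) =
  (t * fy + (1 - t) * fx) + (lx + t * lv)
  + c / 2 * (ip r r + 2 * t * ip r v + t ^+ 2 * ip v v)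
  - (fx + lx + c / 2 * ip r r) by lra.
by field.
Qed.

End Optimality.

(** * Limit points of the iterates and convergence *)

Section Convergence.
Context {R : realType} {N p : nat} {n : 'I_N -> nat}.
Variables (f : forall i, 'cV[R]_(n i) -> R) (X : forall i, set 'cV[R]_(n i)).
Variables (A : forall i, 'M[R]_(p, n i)) (b : 'cV[R]_p) (bs : 'I_N -> 'cV[R]_p).
Variables (E : rel 'I_N) (W : 'M[R]_N) (c : R).
Variables (x : nat -> forall i, 'cV[R]_(n i)) (d lam : nat -> 'I_N -> 'cV[R]_p).
Hypothesis hbs : \sum_i bs i = b.
Hypothesis W_supp : forall i j, ~~ E i j -> W i j = 0.
Hypothesis c_gt0 : 0 < c.
Hypothesis f_convex : forall i, convex_function setT (@f i).
Hypothesis X_convex : forall i, convex_set (@X i).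
Hypothesis X_compact : forall i, compact (@X i).
Hypothesis E_conn : forall i j, connect E i j.
Hypothesis W_ge0 : forall i j, 0 <= W i j.
Hypothesis W_row : forall i, \sum_j W i j = 1.
Hypothesis W_pos : forall i j, (0 < W i j) = E i j.
Hypothesis W_psd : psdmx W.
Hypothesis hadmm : tracking_admm f X A bs E W c x d lam.

Local Notation T := (prod_topology (fun i => 'cV[R]_(n i))).
Local Notation K := [set y : T | forall i, X (y i)].
Local Notation J := (@avgmx R N).

Definition images (y : T) : 'M[R]_(N, p) := rows (fun i => A i *m y i).

(** At a feasible [xs] the Lagrangian does not depend on the multiplier, so only the minimization
    half of the saddle inequalities is recorded. *)
Definition saddle_point (xs : T) (ls : 'cV[R]_p) :=
  [/\ K xs, residual A b xs = 0 & forall y, K y ->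
    \sum_i f (xs i) <= \sum_i f (y i) + dotv ls (residual A b y)].

Let W_sym : W^T = W. Proof. by case: W_psd. Qed.
Let W_pos' i j : E i j -> 0 < W i j. Proof. by rewrite W_pos. Qed.
Let Wip (v : 'M[R]_(N, p)) : 0 <= ip v (W *m v). Proof. exact: psdmx_ip. Qed.

Let Y k := images (x k).
Let D k := rows (d k).
Let Lam k := rows (lam k).
Let B := rows bs.

Let xK k : K (x k).
Proof.
by case: k => [|k] i; [exact: (admm_x0 hadmm)|case: (admm_x hadmm k i)].
Qed.

Let DS k : D k.+1 = W *m D k + Y k.+1 - Y k.
Proof.
rewrite (mulmx_rows _ W_supp) -rowsD -rowsB; congr rows; apply/funext => i.
exact: (admm_d hadmm).
Qed.

Let LamS k : Lam k.+1 = W *m Lam k + c *: D k.+1.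
Proof.
rewrite (mulmx_rows _ W_supp) -rowsZ -rowsD; congr rows; apply/funext => i.
exact: (admm_lam hadmm).
Qed.

Let D0E : J *m D 0%N = J *m (Y 0%N - B).
Proof.
rewrite /B /Y /D -rowsB; congr (_ *m rows _); apply/funext => i.
exact: (admm_d0 hadmm).
Qed.

Lemma admm_minimizes_lagrangian k i (y : 'cV[R]_(n i)) : X y ->
  f (x k.+1 i) + dotv (lam k.+1 i) (A i *m x k.+1 i)
  <= f y + dotv (lam k.+1 i) (A i *m y).
Proof.
move=> Xy; have := admm_x hadmm k i.
under [X in argmin _ X]eq_fun => z do rewrite -(addrA (A i *m z)).
move=> /(augmented_argmin (@f_convex i) (@X_convex i)) /= /(_ y Xy).
have -> : A i *m x k.+1 i + (- (A i *m x k i) + local_mix E W (d k) i) = d k.+1 i.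
  by rewrite (admm_d hadmm); mx_ring.
by rewrite -(admm_lam hadmm).
Qed.

Lemma lagrangian_gap k (y : T) : K y ->
  \sum_i f (x k.+1 i) - \sum_i f (y i) + ip (Lam k.+1) (Y k.+1 - images y) <= 0.
Proof.
move=> Ky; rewrite ipDr ipNr !ip_rows -!sumrB -big_split /=.
apply: sumr_le0 => i _.
have := admm_minimizes_lagrangian k (Ky i); lra.
Qed.

Lemma dual_pairing (l : 'cV[R]_p) (y z : T) :
  ip (rows (fun=> l)) (images y - images z) =
  dotv l (residual A b y) - dotv l (residual A b z).
Proof.
rewrite -!(residual_split A hbs) -rowsB ip_rows -sumrB.
by apply: eq_bigr => i _; rewrite !dotvE !ip_linear; ring.
Qed.

(** Add two inequalities: [x k.+1] minimizes the Lagrangian at [lam k.+1], and [xs] minimizes it at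
    [ls]. The costs cancel. *)
Lemma saddle_mono xs ls : saddle_point xs ls ->
  forall k, ip (Lam k.+1 - rows (fun=> ls)) (Y k.+1 - images xs) <= 0.
Proof.
move=> [Kxs xs_feas xs_min] k; rewrite ipDl ipNl dual_pairing xs_feas.
have := lagrangian_gap k Kxs; have := xs_min _ (xK k.+1).
by rewrite [dotv _ 0]dotvE /ip trmx0 mulmx0 mxtrace0; lra.
Qed.

Lemma avg_images (y : T) :
  J *m (images y - B) = rows (fun=> N%:R^-1 *: residual A b y).
Proof.
rewrite -rowsB avgmx_rows /average; congr rows; apply/funext => _.
by rewrite sumrB hbs.
Qed.

Lemma saddle_avg xs ls : saddle_point xs ls -> J *m images xs = J *m B.
Proof.
move=> [_ xs_feas _]; apply/eqP; rewrite -subr_eq0 -mulmxBr avg_images xs_feas.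
by rewrite scaler0; apply/eqP/matrixP => i j; rewrite !mxE.
Qed.

Let avgD k : J *m D k = J *m (Y k - B).
Proof. exact: (avg_tracking W_sym W_row D0E DS). Qed.

Lemma images_entry_continuous i j : continuous (fun y : T => images y i j).
Proof.
move=> y; have FF : Filter (nbhs y) := nbhs_filter y.
have Ez (z : T) : \sum_h A i j h * z i h 0 = images z i j by rewrite !mxE.
suff H : (fun z : T => \sum_h A i j h * z i h 0) @ y -->
  \sum_h A i j h * y i h 0 by exact: (cvg_eq H Ez (Ez y)).
by apply: cvg_sumr => h _; apply: cvgMl_tmp; exact: coord_cvg.
Qed.

Variables (xs0 : T) (ls0 : 'cV[R]_p).
Hypothesis saddle0 : saddle_point xs0 ls0.

Let JLs0 : J *m rows (fun=> ls0) = rows (fun=> ls0) := avgmx_rows_const ls0.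
Let JYs0 := saddle_avg saddle0.
Let mono0 := saddle_mono saddle0.

Lemma avg_d_vanishes i h : (fun k => (J *m rows (d k)) i h) @ \oo --> (0 : R).
Proof.
exact: (avg_vanishes W_sym W_row W_ge0 Wip E_conn W_pos' c_gt0 D0E DS LamS
  JLs0 JYs0 mono0).
Qed.

Lemma lam_consensus i h :
  (fun k => (rows (lam k) - J *m rows (lam k)) i h) @ \oo --> (0 : R).
Proof.
exact: (dual_consensus W_sym W_row W_ge0 Wip E_conn W_pos' c_gt0 D0E DS LamS
  JLs0 JYs0 mono0).
Qed.

Lemma d_consensus i h :
  (fun k => (rows (d k) - J *m rows (d k)) i h) @ \oo --> (0 : R).
Proof.
exact: (tracking_consensus W_sym W_row W_ge0 Wip E_conn W_pos' c_gt0 D0E DS LamS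
  JLs0 JYs0 mono0).
Qed.

Lemma enorm_average_cvg0 : (fun k => enorm (average (d k))) @ \oo --> (0 : R).
Proof.
apply: cvg_enorm0; under eq_fun do rewrite sqr_enormE.
(* Without agents the matrix [J *m D k] has no row from which to read the average, which is then an
   empty sum. *)
have [N0|N0] := posnP N.
  have av0 k : average (d k) = 0.
    rewrite /average big1 ?scaler0 // => i _.
    by have := ltn_ord i; rewrite [in X in (_ < X)%N]N0.
  under eq_fun do rewrite av0 /ip mul0mx mxtrace0.
  exact: cvg_cst.
apply: cvg_ip0 => h j.
all: have := @avg_d_vanishes (Ordinal N0) h; rewrite (ord1 j).
all: by under eq_fun do rewrite /D avgmx_rows mxE.
Qed.

Lemma images_bounded (V : 'M[R]_(N, p)) :
  exists M, forall y, K y -> ip (images y - V) (images y - V) <= M.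
Proof.
have cV : continuous (fun y : T => - ip (images y - V) (images y - V)).
  move=> y; have FF : Filter (nbhs y) := nbhs_filter y.
  have cE i h : (fun z : T => (images z - V) i h) @ y --> (images y - V) i h.
    have Ez (z : T) : images z i h - V i h = (images z - V) i h by rewrite !entryE.
    suff H : (fun z : T => images z i h - V i h) @ y --> images y i h - V i h.
      exact: (cvg_eq H Ez (Ez y)).
    by apply: cvgB; [exact: images_entry_continuous|exact: cvg_cst].
  by apply: (@cvgN _ _ _ (nbhs y)); apply: cvg_ip.
have [|m _ mP] := compact_EVT_min _ (profiles_compact X_compact)
  (continuous_subspaceT cV); first by exists xs0; case: saddle0.
exists (ip (images m - V) (images m - V)) => y Ky.
by rewrite -lerN2; apply/mP/mem_set.
Qed.

(** The pairs of profile and mean multiplier stay in a compact set. Feasibility and the Lagrangian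
    inequality pass to a limit point, which is therefore a saddle point; the convergent quantity
    attached to it vanishes at that very point. *)
Let limit_saddle : (0 < N)%N -> exists xinf linf (L : R),
  [/\ saddle_point xinf linf,
    (fun k => ip (J *m Lam k - rows (fun=> linf)) (J *m Lam k - rows (fun=> linf))
      + c ^+ 2 * ip (laplacian_inv W *m (Y k - J *m D k - images xinf))
                    (laplacian_inv W *m (Y k - J *m D k - images xinf)))
      @ \oo --> L & L <= 0].
Proof.
move=> N_gt0.
have Nn0 : (N%:R : R) != 0 by rewrite pnatr_eq0 -lt0n.
pose i0 : 'I_N := Ordinal N_gt0.
pose S : topologicalType := (T * 'rV[R]_p)%type.
pose mean k := average (lam k).
have avgLam k : J *m Lam k = rows (fun=> mean k) by rewrite avgmx_rows.
have [M MP] := avg_dual_bounded W_sym W_row W_ge0 Wip E_conn W_pos' c_gt0 D0E DS LamS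
  JLs0 JYs0 mono0.
have M0 : 0 <= M by exact: le_trans (ip_ge0 _) (MP 0%N).
(* A square at most [M] has a root at most [M + 1], which avoids square roots. *)
pose lo h : R := ls0 h 0 - (M + 1).
pose hi h : R := ls0 h 0 + (M + 1).
pose box : set 'rV[R]_p := [set v | forall h, `[lo h, hi h]%classic (v ord0 h)].
have cbox : compact box.
  exact: (@rV_compact R p (fun h => `[lo h, hi h]%classic)
    (fun h => segment_compact (a := lo h) (b := hi h))).
pose u k : S := (x k, (mean k)^T).
have uK k : (K `*` box) (u k).
  split; first exact: xK.
  move=> h; rewrite [(u k).2 _ _]mxE /= in_itv /=.
  have /= := le_trans (sqr_le_ip _ i0 h) (MP k).
  have -> : (J *m Lam k - rows (fun=> ls0)) i0 h = mean k h 0 - ls0 h 0.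
    by rewrite avgLam -rowsB [LHS]mxE !entryE.
  move=> sq.
  have : `|mean k h 0 - ls0 h 0| <= M + 1.
    rewrite -ler_sqr ?nnegrE ?addr_ge0 // real_normK ?num_real //.
    by apply: (le_trans sq); rewrite sqrrD; nra.
  by rewrite ler_norml => /andP[]; rewrite /lo /hi => ? ?; apply/andP; split; lra.
have [[xinf vinf] [Kxinf _] ulim] := @compact_limit_point R S _ u
  (compact_setX (profiles_compact X_compact) cbox) uK.
rewrite /= in Kxinf.
pose q : S := (xinf, vinf).
have FF : Filter (nbhs q) := nbhs_filter q.
pose Lv (v : 'rV[R]_p) : 'M[R]_(N, p) := rows (fun=> v^T).
have c_img i h : (fun z : S => images z.1 i h) @ q --> images xinf i h.
  apply: (@cvg_comp _ _ _ (fun z : S => z.1) (fun y => images y i h) _ (nbhs xinf)).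
    exact: cvg_fst.
  exact: images_entry_continuous.
have c_lv i h : (fun z : S => Lv z.2 i h) @ q --> Lv vinf i h.
  have Ez (v : 'rV[R]_p) : v 0 h = Lv v i h by rewrite !mxE.
  suff H : (fun z : S => z.2 0 h) @ q --> vinf 0 h.
    exact: (cvg_eq H (fun z => Ez z.2) (Ez vinf)).
  apply: (@cvg_comp _ _ _ (fun z : S => z.2) (fun v : 'rV[R]_p => v 0 h) _ (nbhs vinf)).
    exact: cvg_snd.
  exact: coord_continuous.
have c_cost : (fun z : S => \sum_i f (z.1 i)) @ q --> \sum_i f (xinf i).
  apply: (@cvg_comp _ _ _ (fun z : S => z.1) (fun y : T => \sum_i f (y i)) _ (nbhs xinf)).
    exact: cvg_fst.
  exact: (total_cost_continuous f_convex).
have c_sub (U V : S -> 'M[R]_(N, p)) i h :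
    (fun z => U z i h) @ q --> U q i h -> (fun z => V z i h) @ q --> V q i h ->
    (fun z => (U z - V z) i h) @ q --> (U q - V q) i h.
  move=> cU cV.
  have Ez z : U z i h - V z i h = (U z - V z) i h by rewrite !entryE.
  exact: (cvg_eq (cvgB cU cV) Ez (Ez q)).
have res_inf : residual A b xinf = 0.
  suff r0 : ip (residual A b xinf) (residual A b xinf) <= 0.
    apply/matrixP => j h; rewrite [RHS]mxE; apply/eqP.
    by rewrite -sqrf_eq0 eq_le sqr_ge0 andbT (le_trans (sqr_le_ip _ _ _) r0).
  apply: (ulim (fun z => ip (residual A b z.1) (residual A b z.1))).
    apply: (@cvg_comp _ _ _ (fun z : S => z.1)
      (fun y => ip (residual A b y) (residual A b y)) _ (nbhs xinf)).
      exact: cvg_fst.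
    by apply: continuous_sqr_norm => j; exact: residual_entry_continuous.
  apply: (near_le_of_cvg0 (fun k => lexx _)).
  suff cr j h : (fun k => residual A b (x k) j h) @ \oo --> (0 : R).
    exact: cvg_ip0.
  (* Every row of [J *m D k] is the residual of [x k] divided by [N]. *)
  apply: (cvg_eq (cvgMl_tmp (a := N%:R) (avg_d_vanishes i0 j))); last exact: mulr0.
  move=> k; rewrite (ord1 h) -[RHS](mulVKf Nn0); congr (_ * _).
  by rewrite -[LHS]/((J *m D k) i0 j) avgD avg_images [LHS]mxE entryE.
have saddle : saddle_point xinf vinf^T.
  split => // y Ky.
  (* Along the iterates, [g] is the gap of [lagrangian_gap] with the multipliers replaced by their
     mean. The error pairs a bounded matrix with the vanishing consensus error. *)
  pose g (z : S) := \sum_i f (z.1 i) - \sum_i f (y i)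
    + ip (Lv z.2) (images z.1 - images y).
  have : g q <= 0.
    apply: ulim.
      apply: (@cvgD _ _ _ (nbhs q)).
        by apply: (@cvgB _ _ _ (nbhs q)); [exact: c_cost|exact: cvg_cst].
      apply: cvg_ip => // i h.
      by apply: (c_sub (fun z => images z.1) (fun=> images y)) => //; exact: cvg_cst.
    have [M' M'P] := images_bounded (images y).
    have cw : (fun k => ip (- (Y k - images y)) (Lam k - J *m Lam k)) @ \oo --> (0 : R).
      apply: (cvg_ip0_bounded (M := M')); last exact: lam_consensus.
      by move=> k; rewrite ipNl ipNr opprK; exact: M'P (xK k).
    apply: near_le_of_cvg0 cw => k.
    have := lagrangian_gap k Ky.
    rewrite /g /= /Lv trmxK -avgLam ipNl (ipC _ (Lam k.+1 - _)).
    by rewrite !ipDl !ipNl -/(Y k.+1); lra.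
  rewrite /g /Lv /= dual_pairing res_inf.
  by rewrite [dotv _ 0]dotvE /ip trmx0 mulmx0 mxtrace0; lra.
have JYinf := saddle_avg saddle.
have [L cL] := fejer_cvg W_sym W_row W_ge0 Wip E_conn W_pos' c_gt0 D0E DS LamS
  (avgmx_rows_const vinf^T) JYinf (saddle_mono saddle).
exists xinf, vinf^T, L; split => //.
(* By [avgD] the auxiliary sequence is a function of the profile alone, so the quantity tending to
   [L] is a continuous [Q] evaluated along [u], and [Q q] is 0. *)
pose Zf (y : T) := images y - J *m (images y - B).
pose G := laplacian_inv W.
pose Q (z : S) := ip (Lv z.2 - Lv vinf) (Lv z.2 - Lv vinf)
  + c ^+ 2 * ip (G *m (Zf z.1 - images xinf)) (G *m (Zf z.1 - images xinf)).
have Zinf : Zf xinf = images xinf by rewrite /Zf mulmxBr JYinf subrr subr0.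
have : L - Q q <= 0.
  apply: (ulim (fun z => L - Q z)).
    apply: (@cvgB _ _ _ (nbhs q)); first exact: cvg_cst.
    apply: (@cvgD _ _ _ (nbhs q)).
      by apply: cvg_ip => i h; apply: (c_sub (fun z => Lv z.2) (fun=> Lv vinf)) => //;
        exact: cvg_cst.
    apply: (@cvgMl_tmp _ _ (nbhs q)).
    have cGZ i h : (fun z : S => (G *m (Zf z.1 - images xinf)) i h) @ q -->
        (G *m (Zf xinf - images xinf)) i h.
      apply: cvg_mulmx_entry => {}i {}h.
      apply: (c_sub (fun z => Zf z.1) (fun=> images xinf)); last exact: cvg_cst.
      apply: (c_sub (fun z => images z.1) (fun z => J *m (images z.1 - B))) => //.
      apply: (cvg_mulmx_entry (u0 := images xinf - B)) => {}i {}h.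
      by apply: (c_sub (fun z => images z.1) (fun=> B)) => //; exact: cvg_cst.
    exact: cvg_ip.
  have cLQ : (fun k => L - Q (u k)) @ \oo --> (0 : R).
    apply: (cvg_eq (cvgB (cvg_cst L) cL)); last exact: subrr.
    by move=> k; rewrite /Q /u /= /Lv trmxK -avgLam /Zf -avgD.
  by apply: near_le_of_cvg0 cLQ => k.
by rewrite /Q /= Zinf !subrr mulmx0 /ip !mul0mx mxtrace0 mulr0 addr0 subr0.
Qed.

(** The limit [L] is a limit of nonnegative terms and at most 0, so both squares tend to 0.
    Multiplying by [1%:M - W + J] then removes the inverse Laplacian. *)
Lemma dual_primal_cvg : (0 < N)%N -> exists Linf Yinf : 'M[R]_(N, p),
  (forall i h, (fun k => (J *m rows (lam k)) i h) @ \oo --> Linf i h) /\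
  (forall i h, (fun k => (images (x k) - J *m rows (d k)) i h) @ \oo --> Yinf i h).
Proof.
move=> /limit_saddle[xinf [linf [L [_ cL L0]]]].
exists (rows (fun=> linf)), (images xinf).
set l := fun k => _ in cL.
pose dl k := J *m Lam k - rows (fun=> linf).
pose dz k := laplacian_inv W *m (Y k - J *m D k - images xinf).
have lE k : l k = ip (dl k) (dl k) + c ^+ 2 * ip (dz k) (dz k) by [].
have c20 : 0 < c ^+ 2 by rewrite exprn_gt0.
have dz0 k : 0 <= c ^+ 2 * ip (dz k) (dz k).
  by rewrite mulr_ge0 ?ip_ge0 // ltW.
have L00 : L = 0.
  apply/eqP; rewrite eq_le L0 /=; apply: (cvgr_to_ge cL); apply: nearW => k.
  by rewrite lE addr_ge0 ?ip_ge0.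
rewrite {}L00 in cL.
have cdl : (fun k => ip (dl k) (dl k)) @ \oo --> (0 : R).
  apply: squeeze_cvgr cL; last exact: cvg_cst.
  by apply: nearW => k; rewrite ip_ge0 lE lerDl dz0.
have cdz i h : (fun k => dz k i h) @ \oo --> (0 : R).
  apply: (cvg0_sqr_le c20 _ cL) => k; rewrite lE.
  apply: (@le_trans _ _ (c ^+ 2 * ip (dz k) (dz k))).
    by rewrite ler_pM2l // sqr_le_ip.
  by rewrite lerDr ip_ge0.
split=> i h.
  apply: (cvg_eq (cvgD (cvg_entry0 cdl i h) (cvg_cst (rows (fun=> linf) i h)))).
    by move=> k; rewrite -[LHS](addmx_entry (dl k)) /dl subrK.
  exact: add0r.
have U := laplacian_unit W_sym W_row W_ge0 E_conn W_pos'.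
have cZ : (fun k => (Y k - J *m D k - images xinf) i h) @ \oo --> (0 : R).
  apply: (cvg_eq (cvg_mulmx_entry0 (1%:M - W + J) cdz i h)) => // k.
  by rewrite /dz /laplacian_inv mulKVmx.
apply: (cvg_eq (cvgD cZ (cvg_cst (images xinf i h)))).
  by move=> k; rewrite -[LHS](addmx_entry (Y k - J *m D k - images xinf)) subrK.
exact: add0r.
Qed.

End Convergence.

Theorem theorem1 (R : realType) (N p : nat) (n : 'I_N -> nat)
    (f : forall i, 'cV[R]_(n i) -> R) (X : forall i, set 'cV[R]_(n i))
    (A : forall i, 'M[R]_(p, n i)) (b : 'cV[R]_p) (bs : 'I_N -> 'cV[R]_p)
    (E : rel 'I_N) (W : 'M[R]_N) (c : R)
    (x : nat -> forall i, 'cV[R]_(n i)) (d lam : nat -> 'I_N -> 'cV[R]_p)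
    (hbs : \sum_i bs i = b)
    (E_refl : reflexive E)
    (W_supp : forall i j, ~~ E i j -> W i j = 0)
    (c_gt0 : 0 < c)
    (f_convex : forall i, convex_function setT (f i))
    (X_convex : forall i, convex_set (X i))
    (X_compact : forall i, compact (X i))
    (primal_sol : exists xs, primal_optimal f X A b xs)
    (dual_sol : exists ls, dual_optimal f X A bs ls)
    (E_sym : symmetric E)
    (E_conn : forall i j, connect E i j)
    (W_range : forall i j, 0 <= W i j < 1)
    (W_sym : forall i j, W i j = W j i)
    (W_col : forall j, \sum_i W i j = 1)
    (W_row : forall i, \sum_j W i j = 1)
    (W_pos : forall i j, (0 < W i j) = E i j)
    (W_psd : psdmx W)
    (hadmm : tracking_admm f X A bs E W c x d lam) :
  [/\ (fun k => enorm (consensus_error (d k))) @ \oo --> (0 : R),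
      (fun k => enorm (consensus_error (lam k))) @ \oo --> (0 : R),
      (fun k => enorm (average (d k))) @ \oo --> (0 : R) &
      forall xs ls, primal_optimal f X A b xs -> dual_optimal f X A bs ls ->
        let z k := blkdiag A *m stack (x k) - ones_kron (average (d k)) in
        cvgn (fun k =>
          enorm (ones_kron (N := N) (average (lam k)) - ones_kron ls) ^+ 2
          + c ^+ 2 * enorm (z k - blkdiag A *m stack xs) ^+ 2)].
Proof.
have W_ge0 i j : 0 <= W i j by case/andP: (W_range i j).
have [xs0 xs0P] := primal_sol; have [ls0 ls0P] := dual_sol.
have saddle0 : saddle_point f X A b xs0 ls0.
  have [[xs0_b Xxs0] _] := xs0P.
  split=> [//||y Ky]; first by rewrite /residual xs0_b subrr.
  exact: strong_duality hbs f_convex X_convex X_compact _ _ _ xs0P ls0P Ky.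
split.
- apply: consensus_cvg0.
  exact: (d_consensus hbs W_supp c_gt0 f_convex X_convex E_conn W_ge0 W_row
    W_pos W_psd hadmm saddle0).
- apply: consensus_cvg0.
  exact: (lam_consensus hbs W_supp c_gt0 f_convex X_convex E_conn W_ge0 W_row
    W_pos W_psd hadmm saddle0).
- exact: (enorm_average_cvg0 hbs W_supp c_gt0 f_convex X_convex E_conn W_ge0
    W_row W_pos W_psd hadmm saddle0).
move=> xs ls _ _ z.
pose u k : 'M[R]_(N, p) := avgmx *m rows (lam k) - rows (fun=> ls).
pose v k : 'M[R]_(N, p) :=
  images A (x k) - avgmx *m rows (d k) - images A xs.
suff [L cL] : exists L : R,
    (fun k => ip (u k) (u k) + c ^+ 2 * ip (v k) (v k)) @ \oo --> L.
  apply/cvg_ex; exists L; apply: (cvg_eq cL) => // k.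
  rewrite /z !blkdiag_stack /ones_kron -!stackpB !sqr_enorm_stackp !rowsB.
  by rewrite -!avgmx_rows.
have [N0|N_gt0] := posnP N.
  have ip0 (w w' : 'M[R]_(N, p)) : ip w w' = 0.
    rewrite ipE big1 // => i _.
    by have := ltn_ord i; rewrite [in X in (_ < X)%N]N0.
  by exists 0; under eq_fun do rewrite !ip0 mulr0 addr0; exact: cvg_cst.
have [Linf [Yinf [cL cY]]] := dual_primal_cvg hbs W_supp c_gt0 f_convex X_convex
  X_compact E_conn W_ge0 W_row W_pos W_psd hadmm saddle0 N_gt0.
have cvg_sub (w : nat -> 'M[R]_(N, p)) w0 w1 :
    (forall i h, (fun k => w k i h) @ \oo --> (w0 : 'M[R]_(N, p)) i h) ->
    forall i h, (fun k => (w k - w1) i h) @ \oo --> (w0 - w1) i h.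
  move=> cw i h; rewrite addmx_entry; under eq_fun do rewrite addmx_entry.
  by apply: cvgD; [exact: cw|exact: cvg_cst].
(* The mean multipliers and the auxiliary sequence converge themselves, so the squared distances
   converge to those of the limits. *)
exists (ip (Linf - rows (fun=> ls)) (Linf - rows (fun=> ls))
  + c ^+ 2 * ip (Yinf - images A xs) (Yinf - images A xs)).
apply: cvgD; first by apply: cvg_ip; exact: cvg_sub.
by apply: cvgMl_tmp; apply: cvg_ip; exact: cvg_sub.
Qed.
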